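(* Let the positive integer $m$ and the real numbers $\alpha,\gamma$ be such that $$1\le m\le N,\qquad 0<\gamma<N,\qquad 0<\alpha<\frac2{\gamma+m}.$$ Suppose that $\varphi\in L^1_{\rm loc}(\mathbb R^N\setminus\{0\})$ is anti-symmetric with respect to $x_1,x_2,\dots,x_m$, that $\varphi_{|\Omega_m}\in\mathcal X$, that $\varphi\ge0$ in $\Omega_m$, and that $\varphi(x)\ge\omega(x)\psi_0(x)$ for $x\in\Omega_m\cap\{|x|\le\epsilon\}$, for some $\epsilon>0$, where $\omega\in L^\infty(\mathbb R^N)$ is homogeneous of degree $0$, anti-symmetric with respect to $x_1,\dots,x_m$, $\omega\ge0$ on $\Omega_m$ and $\omega\not\equiv0$. Then, for the equation $\partial_tu=\Delta u+|u|^\alpha u$ on $\mathbb R^N$ with $u(0)=\lambda\varphi$, one has $T_{\max}(\lambda\varphi)<\infty$ for $\lambda>0$ sufficiently large and $$\limsup_{\lambda\to\infty}\lambda^{\left(\frac1\alpha-\frac{\gamma+m}2\right)^{-1}}T_{\max}(\lambda\varphi)\ \le\ \frac1{\left(\alpha^{1/\alpha}\left\|e^{\Delta_m}(\omega\psi_0)\right\|_\infty\right)^{\left(\frac1\alpha-\frac{\gamma+m}2\right)^{-1}}} .$$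
   Context: $\Omega_m=\{x\in\mathbb R^N: x_1>0,\dots,x_m>0\}$. The function $\psi_0:\Omega_m\to\mathbb R$ is $\psi_0(x)=c_{m,\gamma}\,x_1\cdots x_m\,|x|^{-\gamma-2m}$ with $c_{m,\gamma}=\gamma(\gamma+2)\cdots(\gamma+2m-2)$, and $\mathcal X=\{\psi\in L^1_{\rm loc}(\Omega_m):\ \psi/\psi_0\in L^\infty(\Omega_m)\}$. A function is anti-symmetric with respect to $x_1,\dots,x_m$ if for each $i\le m$ it changes sign under the reflection $x_i\mapsto-x_i$. $e^{t\Delta_m}$ is the (Dirichlet) heat semigroup on $\Omega_m$, with kernel $\prod_{i=1}^m\big(g_t(x_i-y_i)-g_t(x_i+y_i)\big)\prod_{i=m+1}^Ng_t(x_i-y_i)$, $g_t(s)=(4\pi t)^{-1/2}e^{-s^2/4t}$; $e^{\Delta_m}$ is its value at $t=1$ and $\|\cdot\|_\infty$ here is the norm of $L^\infty(\Omega_m)$. For $u_0=\lambda\varphi$ with $\lambda>0$ and $\varphi\in L^1_{\rm loc}(\mathbb R^N\setminus\{0\})$ anti-symmetric with respect to $x_1,\dots,x_m$, $\varphi_{|\Omega_m}\in\mathcal X$, $\varphi\ge0$ in $\Omega_m$ (where $1\le m\le N$, $0<\gamma<N$, $0<\alpha<\frac2{\gamma+m}$), the Cauchy problem $\partial_tu=\Delta u+|u|^\alpha u$ on $\mathbb R^N$, $u(0)=u_0$, is known to be locally well-posed in the class of anti-symmetric functions, and the solution extends to a maximal solution $u:(0,T_{\max}(u_0))\to C_0(\mathbb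 R^N)$, anti-symmetric with respect to $x_1,\dots,x_m$, whose restriction to $\Omega_m$ is nonnegative and satisfies $u(t)=e^{t\Delta_m}u_0+\int_0^te^{(t-\sigma)\Delta_m}[|u(\sigma)|^\alpha u(\sigma)]\,d\sigma$; $T_{\max}(u_0)$ is its existence time. $C_0(\mathbb R^N)$ is the space of continuous functions vanishing at infinity. *)

(* Defs.v *)
From HB Require Import structures.
From mathcomp Require Import all_boot all_order all_algebra.
From mathcomp Require Import all_classical all_reals all_analysis.

Set Implicit Arguments.
Unset Strict Implicit.
Unset Printing Implicit Defensive.
Import Order.TTheory GRing.Theory Num.Theory.
Import numFieldNormedType.Exports.
Local Open Scope classical_set_scope.
Local Open Scope ring_scope.

(* Points of R^N are row vectors 'rV[R]_N: these already carry the usual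
   topology, and are given here the sigma-algebra generated by the
   coordinates, i.e. the Borel sets of R^N. *)
Section measurable_rV.
Context {d : measure_display} {T : measurableType d}.
Variable n : nat.

Let coor : 'I_n -> 'rV[T]_n -> T := fun i x => x ord0 i.

Let rV_set0 : g_sigma_preimage coor set0.
Proof. exact: sigma_algebra0. Qed.

Let rV_setC A : g_sigma_preimage coor A -> g_sigma_preimage coor (~` A).
Proof. exact: sigma_algebraC. Qed.

Let rV_bigcup (F : (set 'rV[T]_n)^nat) :
  (forall i, g_sigma_preimage coor (F i)) ->
  g_sigma_preimage coor (\bigcup_i (F i)).
Proof. exact: sigma_algebra_bigcup. Qed.

HB.instance Definition _ := @isMeasurable.Build (measure_tuple_display d)
  'rV[T]_n (g_sigma_preimage coor) rV_set0 rV_setC rV_bigcup.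

End measurable_rV.

Section measurable_fun_rV.
Context {d d' : measure_display} {S : measurableType d'} {T : measurableType d}.

Lemma measurable_coor n (i : 'I_n) :
  measurable_fun [set: 'rV[T]_n] (fun x : 'rV[T]_n => x ord0 i).
Proof.
move=> _ Y mY; rewrite setTI; apply: sub_sigma_algebra => /=.
case: n i => [[] []//|n i].
rewrite -bigcup_mkord_ord; exists i; first exact: ltn_ord.
by exists Y => //; rewrite setTI inord_val.
Qed.

Lemma measurable_fun_rV n (f : S -> 'rV[T]_n) :
  (forall i, measurable_fun [set: S] (fun s => f s ord0 i)) ->
  measurable_fun [set: S] f.
Proof.
move=> mf.
suff fm : g_sigma_preimage (fun i s => f s ord0 i) `<=` measurable.
  move=> _ A mA; apply: fm.
  have := g_sigma_preimage_comp (fun (i : 'I_n) (x : 'rV[T]_n) => x ord0 i) f.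
  by rewrite /comp => ->; exists A.
apply: smallest_sub; first exact: sigma_algebra_measurable.
case: n => [|n] in f mf *; first by rewrite big_ord0.
rewrite -bigcup_mkord_ord; apply: bigcup_sub => i Ii.
by move=> A [B mB <-]; exact: mf.
Qed.

End measurable_fun_rV.

(* Lebesgue measure on R^n, built as the n-fold iterated product of the
   Lebesgue measure of the line, transported by R * R^n ~ R^n.+1. *)
Section lebesgue_step.
Context {R : realType}.
Variable n : nat.

Definition rV_cons (p : measurableTypeR R * 'rV[R]_n) : 'rV[R]_n.+1 :=
  \row_i oapp (p.2 ord0) p.1 (unlift ord0 i).

Definition rV_uncons (x : 'rV[R]_n.+1) : measurableTypeR R * 'rV[R]_n :=
  (x ord0 ord0, \row_i x ord0 (lift ord0 i)).

Lemma rV_consK : cancel rV_cons rV_uncons.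
Proof.
move=> [a v]; congr pair; first by rewrite mxE unlift_none.
by apply/rowP => i; rewrite !mxE liftK.
Qed.

Lemma rV_unconsK : cancel rV_uncons rV_cons.
Proof.
by move=> x; apply/rowP => i; rewrite mxE; case: unliftP => [j|] -> //=; rewrite mxE.
Qed.

Lemma measurable_rV_cons : measurable_fun [set: measurableTypeR R * 'rV[R]_n] rV_cons.
Proof.
apply: (measurable_fun_rV (T := R)) => i.
under eq_fun do rewrite mxE.
case: unliftP => [j|] _ /=; last exact: measurable_fst.
by apply: (measurableT_comp (measurable_coor (T := R) j)); exact: measurable_snd.
Qed.

Lemma measurable_rV_uncons : measurable_fun [set: 'rV[R]_n.+1] rV_uncons.
Proof.
apply/measurable_fun_pairP; split; first exact: (measurable_coor (T := R)).
apply: (measurable_fun_rV (T := R)) => i.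
under eq_fun do rewrite mxE.
exact: (measurable_coor (T := R)).
Qed.

Variable nu : {sigma_finite_measure set (measurableTypeR R) -> \bar R}.
Variable mu : {sigma_finite_measure set 'rV[R]_n -> \bar R}.

Definition lebesgue_rVS : set 'rV[R]_n.+1 -> \bar R :=
  pushforward (nu \x mu)%E rV_cons.

Let mcons A : measurable A -> measurable (rV_cons @^-1` A).
Proof. by move=> mA; rewrite -[X in measurable X]setTI; exact: measurable_rV_cons. Qed.

Let lebesgue_rVS0 : lebesgue_rVS set0 = 0%E.
Proof. by rewrite /lebesgue_rVS /pushforward preimage_set0 measure0. Qed.

Let lebesgue_rVS_ge0 A : (0 <= lebesgue_rVS A)%E.
Proof. exact: (measure_ge0 (nu \x mu)%E). Qed.

Let lebesgue_rVS_sigma_additive : semi_sigma_additive lebesgue_rVS.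
Proof.
move=> F mF tF mUF; rewrite /lebesgue_rVS /pushforward preimage_bigcup.
apply: measure_semi_sigma_additive.
- by move=> k; exact: mcons.
- apply/trivIsetP => /= i j _ _ ij; rewrite -preimage_setI.
  by move/trivIsetP : tF => /(_ _ _ _ _ ij) ->//; rewrite preimage_set0.
- by rewrite -preimage_bigcup; exact: mcons.
Qed.

HB.instance Definition _ := isMeasure.Build _ _ _ lebesgue_rVS
  lebesgue_rVS0 lebesgue_rVS_ge0 lebesgue_rVS_sigma_additive.

Let lebesgue_rVS_sigma_finite : sigma_finite setT lebesgue_rVS.
Proof.
have /sigma_finiteP[F [FT ndF Foo]] := sigma_finiteT nu.
have /sigma_finiteP[G [GT ndG Goo]] := sigma_finiteT mu.
exists (fun k => rV_uncons @^-1` (F k `*` G k)) => [|k].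
  rewrite -preimage_bigcup -[LHS](preimage_setT rV_uncons); congr (_ @^-1` _).
  rewrite -setXTT FT GT predeqE => -[x y]; split.
    move=> [/= [k _ Fkx] [l _ Gly]]; exists (maxn k l) => //; split.
    - by move: x Fkx; exact/subsetPset/ndF/leq_maxl.
    - by move: y Gly; exact/subsetPset/ndG/leq_maxr.
  by move=> [k _ []/= ? ?]; split; exists k.
have [mF Fky] := Foo k; have [mG Gky] := Goo k; split.
  rewrite -[X in measurable X]setTI; apply: measurable_rV_uncons => //.
  exact: measurableX.
rewrite /lebesgue_rVS /pushforward -comp_preimage.
rewrite (_ : rV_uncons \o rV_cons = id); last first.
  by apply/funext => p; exact: rV_consK.
by rewrite preimage_id product_measure1E// lte_mul_pinfty// ge0_fin_numE.
Qed.

HB.instance Definition _ := @Measure_isSigmaFinite.Build _ _ _ lebesgue_rVS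
  lebesgue_rVS_sigma_finite.

End lebesgue_step.

Fixpoint lebesgue_rV (R : realType) (n : nat) :
    {sigma_finite_measure set 'rV[R]_n -> \bar R} :=
  match n with
  | 0 => \d_ (0 : 'rV[R]_0)
  | n'.+1 => lebesgue_rVS (@lebesgue_measure R) (lebesgue_rV R n')
  end.

Section function_spaces.
Context {R : realType} {N : nat}.
Implicit Types (x : 'rV[R]_N) (D : set 'rV[R]_N) (f : 'rV[R]_N -> R).
Local Notation leb := (lebesgue_rV R N).

(* The Euclidean norm; the library's `|x| is the sup norm. *)
Definition enorm x : R := Num.sqrt (\sum_i x ord0 i ^+ 2).

(* Elements of L^1_loc and L^oo are represented by Borel functions, and
   pointwise conditions on them are required almost everywhere. *)
Definition L1loc D f := measurable_fun D f /\
  forall K, K `<=` D -> compact K -> (\int[leb]_(x in K) `|f x|%:E < +oo)%E.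

Definition Linfty D f := measurable_fun D f /\ finite_norm leb +oo%E (f \_ D).

Definition C0 f := continuous f /\
  forall e, 0 < e -> exists M, forall x, M < enorm x -> `|f x| < e.

Definition reflect_coord (i : 'I_N) x : 'rV[R]_N :=
  \row_j if j == i then - x ord0 j else x ord0 j.

(* Coordinates are numbered from 0: x_1, ..., x_m are the x ord0 i with
   i < m. *)
Definition antisymmetric_coords (m : nat) f := forall i : 'I_N, (i < m)%N ->
  {ae leb, forall x, f (reflect_coord i x) = - f x}.

Definition homogeneous0 f := forall r : R, 0 < r ->
  {ae leb, forall x, f (r *: x) = f x}.

End function_spaces.

Section heat_equation.
Context {R : realType} {N : nat}.
Implicit Types (m : nat) (alpha gamma t : R) (x y : 'rV[R]_N).
Local Notation leb := (lebesgue_rV R N).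

Definition Omega m : set 'rV[R]_N :=
  [set x | forall i : 'I_N, (i < m)%N -> 0 < x ord0 i].

Definition psi0 m gamma x : R :=
  (\prod_(k < m) (gamma + 2 * k%:R)) * (\prod_(i < N | (i < m)%N) x ord0 i) *
  enorm x `^ (- gamma - 2 * m%:R).

Definition Xspace m gamma (psi : 'rV[R]_N -> R) :=
  L1loc (Omega m) psi /\ Linfty (Omega m) (fun x => psi x / psi0 m gamma x).

Definition gauss t (s : R) : R :=
  (4 * pi * t) `^ (- 2^-1) * expR (- (s ^+ 2 / (4 * t))).

Definition heat_kernel m t x y : R :=
  \prod_(i < N) if (i < m)%N
    then gauss t (x ord0 i - y ord0 i) - gauss t (x ord0 i + y ord0 i)
    else gauss t (x ord0 i - y ord0 i).

(* e^{t Delta_m} f *)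
Definition heat m t (f : 'rV[R]_N -> R) x : \bar R :=
  (\int[leb]_(y in Omega m) (heat_kernel m t x y * f y)%:E)%E.

(* A solution on (0, T): a continuous curve in C_0(R^N), for the uniform
   norm, that is antisymmetric, nonnegative on Omega m, and satisfies the
   integral equation there; all the integrands are nonnegative, so the
   integrals make sense in \bar R.  The values of u outside (0, T) are
   irrelevant. *)
Record mild_solution m alpha (u0 : 'rV[R]_N -> R) (T : \bar R)
    (u : R -> 'rV[R]_N -> R) : Prop := MildSolution {
  sol_time : (0 < T)%E ;
  sol_C0 : forall t, 0 < t -> (t%:E < T)%E -> C0 (u t) ;
  sol_continuous : forall t, 0 < t -> (t%:E < T)%E ->
    {uniform, u @ t --> u t} ;
  sol_antisymmetric : forall t, 0 < t -> (t%:E < T)%E ->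
    antisymmetric_coords m (u t) ;
  sol_ge0 : forall t, 0 < t -> (t%:E < T)%E ->
    forall x, Omega m x -> 0 <= u t x ;
  sol_duhamel : forall t, 0 < t -> (t%:E < T)%E -> forall x, Omega m x ->
    (u t x)%:E = (heat m t u0 x +
      \int[lebesgue_measure]_(s in `]0%R, t[)
        heat m (t - s) (fun y => (`|u s y| `^ alpha * u s y)%R) x)%E }.

(* The existence time of the maximal solution, as the supremum of the
   (possibly infinite) times T for which there is a solution on (0, T).
   Should several solutions share the same u0, the smallest one, i.e. the
   limit of the Picard iterates from 0, lives longest and has this lifespan. *)
Definition Tmax m alpha (u0 : 'rV[R]_N -> R) : \bar R :=
  ereal_sup [set T | exists u, mild_solution m alpha u0 T u].

End heat_equation.

(* Main.v *)
Require Import Defs.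
From HB Require Import structures.
From mathcomp Require Import all_boot all_order all_algebra.
From mathcomp Require Import all_classical all_reals all_analysis.
From mathcomp Require Import measurable_realfun ess_sup_inf ring lra.
Import Order.TTheory GRing.Theory Num.Theory.
Import numFieldNormedType.Exports.
Local Open Scope classical_set_scope.
Local Open Scope ring_scope.

(* Fix t < T and x, and put Phi(s) = (e^{(t-s)Delta_m} u(s))(x).  By Duhamel's
   formula, the semigroup property and Tonelli, Phi is A = (e^{t Delta_m} u_0)(x)
   plus the integral over (0, s) of e^{(t-r)Delta_m}(u(r)^{1+alpha})(x), which is at
   least Phi(r)^{1+alpha} by Jensen's inequality.  As Phi stays finite up to time t,
   comparison with y' = y^{1+alpha}, y(0) = A gives alpha t A^alpha <= 1.
   For u_0 = lambda phi, bounding phi below by omega psi_0 on |x| <= eps and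
   rescaling x by sqrt t turns this into
     alpha^{1/alpha} lambda t^{1/alpha - (gamma+m)/2}
       e^{Delta_m}(omega psi_0 1_{|x| <= eps/sqrt t})(x) <= 1,
   and the cut-off disappears in the limit since t -> 0 as lambda -> oo. *)

(** No regularity of Phi in s is established, so the comparison is discrete: only the increment
    bound Phi(s1) + (s2 - s1) Phi(s1)^{1+alpha} <= Phi(s2) is used, and an explicit Euler scheme
    replaces the differential inequality. All integrands are nonnegative and extended-real valued,
    so Tonelli needs no integrability; the price is that subtraction is avoided, which dictates the
    form of the Gaussian identities and of Jensen's inequality. Finiteness comes from the solution:
    Duhamel's formula at time t bounds Phi by the real number u(t,x). Tonelli also needs u jointly
    measurable in (s,y), which continuity in C_0 provides. Signs are known only almost everywhere,
    so phi and omega psi_0 are replaced by everywhere nonnegative Borel functions. Anti-symmetry of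
    omega ensures that omega is not null inside Omega_m. In the limit the norm is not approached by
    values at chosen points: a positive limsup fixes a ceiling for all cut-off heat values at once,
    monotone convergence passes it to the full profile, and so to the norm. *)

Local Notation pushm :=
  measure_function_pushforward__canonical__measure_function_Measure.

(** * Dilations of Lebesgue measure on the line *)

Section line.
Context {R : realType}.
Local Notation mR := (measurableTypeR R).
Local Notation mu := (@lebesgue_measure R).
Local Open Scope ereal_scope.

(** For a positive factor, the rescaled pushforward agrees with Lebesgue measure on half-open
    intervals, and uniqueness of the latter concludes; a negative factor is reduced to this by the
    reflection of the line. *)
Lemma lebesgue_measure_dilation (c : R) (A : set mR) : (c != 0)%R -> measurable A ->
  mu [set x | A (c * x)%R] = `|c|^-1%:E * mu A.
Proof.
move=> c0 mA.
have mc (c' : R) : measurable_fun [set: mR] (( *%R c') : mR -> mR).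
  exact: measurable_funM.
have pos (a : R) (B : set mR) : (0 < a)%R -> measurable B ->
    mu (( *%R a) @^-1` B) = a^-1%:E * mu B.
  move=> a0 mB.
  have a0' : (0 <= a)%R by exact: ltW.
  pose m1 : measure mR R := pushm mu (mc a).
  suff : mu B = mscale (NngNum a0') m1 B.
    rewrite [RHS](_ : _ = a%:E * mu (( *%R a) @^-1` B))// => ->.
    by rewrite muleA -EFinM mulVf ?gt_eqF// mul1e.
  apply: lebesgue_measure_unique => // _ [[x y]] _ <-.
  rewrite [RHS](_ : _ = a%:E * mu [set z | `]x, y]%classic (a * z)%R])//.
  have -> : [set z | `]x, y]%classic (a * z)%R] = `](a^-1 * x)%R, (a^-1 * y)%R]%classic :> set R.
    apply/seteqP; split => z /=; rewrite !in_itv/= => /andP[h1 h2]; apply/andP; split.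
    - by rewrite mulrC ltr_pdivrMr// mulrC.
    - by rewrite mulrC ler_pdivlMr// mulrC.
    - by move: h1; rewrite mulrC ltr_pdivrMr// mulrC.
    - by move: h2; rewrite mulrC ler_pdivlMr// mulrC.
  rewrite !lebesgue_measure_itv/= !lte_fin ltr_pM2l ?invr_gt0//.
  case: ifPn => _; last by rewrite mule0.
  by rewrite -!EFinD -EFinM mulrBr !mulrA divff ?gt_eqF// !mul1r.
have [c_gt0|c_lt0|/eqP] := ltgtP 0%R c; last by rewrite eq_sym (negPf c0).
- by rewrite -pos ?gtr0_norm.
- rewrite ltr0_norm// -pos ?oppr_gt0//.
  have := @lebesgue_measureN R (( *%R (- c)) @^-1` A); rewrite /pushforward => <-.
    by congr (mu _); apply/seteqP; split => z /=; rewrite mulrNN.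
  by rewrite -[X in measurable X]setTI; exact: mc.
Qed.

Lemma ge0_integral_dilation (c : R) (f : mR -> \bar R) : (c != 0)%R ->
  measurable_fun [set: mR] f -> (forall x, 0 <= f x) ->
  \int[mu]_x f (c * x)%R = `|c|^-1%:E * \int[mu]_x f x.
Proof.
move=> c0 mf f0.
have mc : measurable_fun [set: mR] (( *%R c) : mR -> mR) by exact: measurable_funM.
have ci : (0 <= `|c|^-1)%R by rewrite invr_ge0.
transitivity (\int[pushm mu mc]_x f x).
  by rewrite ge0_integral_pushforward.
transitivity (\int[mscale (NngNum ci) mu]_x f x).
  by apply: eq_measure_integral => A mA _; exact: lebesgue_measure_dilation.
by rewrite ge0_integral_mscale.
Qed.
End line.

(** * Tonelli, product integrands and dilations in R^n *)

Section lebesgue_rV_integral.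
Context {R : realType}.
Local Notation mR := (measurableTypeR R).
Local Notation mu := (@lebesgue_measure R).
Local Notation leb := (lebesgue_rV R).
Local Open Scope ereal_scope.

Lemma lebesgue_rV_integral0 (f : 'rV[R]_0 -> \bar R) : (forall x, 0 <= f x) ->
  \int[leb 0]_x f x = f 0%R.
Proof.
move=> f0; rewrite (_ : f = cst (f 0%R)); last first.
  by apply/funext => x; rewrite /cst; congr f; apply/rowP => -[].
by rewrite integral_cst//= diracT mule1.
Qed.

Lemma lebesgue_rV_integralS n (f : 'rV[R]_n.+1 -> \bar R) :
  measurable_fun [set: 'rV[R]_n.+1] f -> (forall x, 0 <= f x) ->
  \int[leb n.+1]_x f x = \int[mu]_a \int[leb n]_v f (rV_cons (a, v)).
Proof.
move=> mf f0.
transitivity (\int[pushm (mu \x leb n) (@measurable_rV_cons R n)]_x f x).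
  exact: eq_measure_integral.
rewrite ge0_integral_pushforward//=; last exact: measurable_rV_cons.
rewrite preimage_setT (fubini_tonelli1 (f \o @rV_cons R n))//=.
by apply: measurableT_comp => //; exact: measurable_rV_cons.
Qed.

Lemma measurable_rV_cons2 n (f : 'rV[R]_n.+1 -> \bar R) a :
  measurable_fun [set: 'rV[R]_n.+1] f ->
  measurable_fun [set: 'rV[R]_n] (fun v => f (rV_cons (a, v))).
Proof.
move=> mf.
apply: (measurableT_comp mf).
apply: (measurableT_comp (@measurable_rV_cons R n)).
exact: measurable_pair1.
Qed.

(** Induction on the dimension by Tonelli. It reduces every identity for the heat kernel, a product
    over coordinates, to one dimension. *)
Lemma ge0_integral_prod n (f : 'I_n -> mR -> R) :
  (forall i, measurable_fun [set: mR] (f i)) ->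
  (forall i x, (0 <= f i x)%R) ->
  \int[leb n]_x (\prod_i f i (x ord0 i))%R%:E = \prod_i \int[mu]_a (f i a)%:E.
Proof.
elim: n f => [|n IH] f mf f0.
  rewrite lebesgue_rV_integral0 ?big_ord0// => x.
  by rewrite big_ord0 lee_fin.
have mpr k (g : 'I_k -> mR -> R) : (forall i, measurable_fun [set: mR] (g i)) ->
    measurable_fun [set: 'rV[R]_k] (fun x => (\prod_i g i (x ord0 i))%R%:E).
  move=> mg; apply/measurable_EFinP; apply: measurable_prod => i _.
  by apply: (measurableT_comp (mg i)); exact: (measurable_coor (T := R)).
rewrite lebesgue_rV_integralS; first last.
- by move=> x; rewrite lee_fin; apply: prodr_ge0.
- exact: (mpr _ f).
rewrite big_ord_recl -(IH (fun i => f (lift ord0 i)))//.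
rewrite -ge0_integralZr//; first last.
- by apply: integral_ge0 => x _; rewrite lee_fin; apply: prodr_ge0.
- by move=> x _; rewrite lee_fin.
- exact/measurable_EFinP.
apply: eq_integral => a _.
rewrite -ge0_integralZl//; first last.
- by rewrite lee_fin.
- by move=> x _; rewrite lee_fin; apply: prodr_ge0 => i _.
- exact: (mpr _ (fun i => f (lift ord0 i))).
apply: eq_integral => v _.
rewrite -EFinM big_ord_recl; congr (_ * _)%:E.
  by rewrite mxE unlift_none.
by apply: eq_bigr => i _; rewrite mxE liftK.
Qed.

(** Each coordinate has its own factor, so that one change of variables serves both the parabolic
    rescaling (equal factors) and the reflections (factors 1 and -1). *)
Definition rV_dilate {n} (c : 'I_n -> R) (x : 'rV[R]_n) : 'rV[R]_n :=
  \row_i (c i * x ord0 i)%R.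

Lemma measurable_rV_dilate n (c : 'I_n -> R) :
  measurable_fun [set: 'rV[R]_n] (rV_dilate c).
Proof.
apply: (measurable_fun_rV (T := R)) => i; under eq_fun do rewrite mxE.
by apply: measurable_funM => //; exact: (measurable_coor (T := R)).
Qed.

Lemma ge0_integral_rV_dilate n (c : 'I_n -> R) (f : 'rV[R]_n -> \bar R) :
  (forall i, c i != 0)%R ->
  measurable_fun [set: 'rV[R]_n] f -> (forall x, 0 <= f x) ->
  \int[leb n]_x f (rV_dilate c x) = (\prod_i `|c i|^-1)%R%:E * \int[leb n]_x f x.
Proof.
elim: n c f => [|n IH] c f c0 mf f0.
  rewrite !lebesgue_rV_integral0// big_ord0 mul1e.
  by congr f; apply/rowP => -[].
have mfd : measurable_fun [set: 'rV[R]_n.+1] (fun x => f (rV_dilate c x)).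
  by apply: (measurableT_comp mf); exact: measurable_rV_dilate.
rewrite !lebesgue_rV_integralS//.
have dE a v : rV_dilate c (rV_cons (a, v)) =
    rV_cons (c ord0 * a, rV_dilate (fun i => c (lift ord0 i)) v)%R.
  apply/rowP => i; rewrite !mxE /=.
  by case: unliftP => [j|] -> /=; rewrite ?mxE.
under eq_integral => a _.
  under eq_integral => v _ do rewrite dE.
  rewrite (IH _ (fun v => f (rV_cons (c ord0 * a, v)%R)))//; last first.
    exact: measurable_rV_cons2.
  over.
have mF : measurable_fun [set: mR] (fun a => \int[leb n]_v f (rV_cons (a, v))).
  apply: (@measurable_fun_fubini_tonelli_F _ _ _ _ _ (leb n) (fun p => f (rV_cons p))) => //.
  by apply: (measurableT_comp mf); exact: measurable_rV_cons.
rewrite (@ge0_integral_dilation _ (c ord0) (fun a => (\prod_(i < n) `|c (lift ord0 i)|^-1)%:E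
   * \int[leb n]_v f (rV_cons (a, v))))//; first last.
- move=> x; apply: mule_ge0; last exact: integral_ge0.
  by rewrite lee_fin; apply: prodr_ge0 => i _; rewrite invr_ge0.
- exact: measurable_funeM.
rewrite ge0_integralZl//; first last.
- by rewrite lee_fin; apply: prodr_ge0 => i _; rewrite invr_ge0.
- by move=> x _; exact: integral_ge0.
by rewrite muleA -EFinM big_ord_recl.
Qed.

End lebesgue_rV_integral.

(** * The Gaussian and the Dirichlet heat kernel of the half-line *)

Section gauss.
Context {R : realType}.
Local Notation mR := (measurableTypeR R).
Local Notation mu := (@lebesgue_measure R).
Implicit Types t s x y z : R.

Lemma gauss_ge0 t s : 0 <= gauss t s.
Proof. by rewrite /gauss mulr_ge0 ?powR_ge0 ?expR_ge0. Qed.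

Lemma gauss_gt0 t s : 0 < t -> 0 < gauss t s.
Proof.
by move=> t0; rewrite /gauss mulr_gt0 ?expR_gt0// powR_gt0// !mulr_gt0 ?pi_gt0.
Qed.

Lemma gaussN t s : gauss t (- s) = gauss t s.
Proof. by rewrite /gauss sqrrN. Qed.

Lemma gauss_normal_pdf t x y : 0 < t ->
  gauss t (x - y) = normal_pdf x (Num.sqrt (2 * t)) y.
Proof.
move=> t0; rewrite normal_pdfE; last by rewrite gt_eqF// sqrtr_gt0 mulr_gt0.
rewrite /gauss /normal_peak /normal_fun sqr_sqrtr ?mulr_ge0 ?ltW//.
have pi0 := @pi_gt0 R.
rewrite powRN powR12_sqrt ?mulr_ge0 ?ltW//.
congr (_^-1 * expR _); first by congr (Num.sqrt _); rewrite -mulr_natr; ring.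
by rewrite -mulr_natr -opprB sqrrN mulNr; congr (- (_ / _)); ring.
Qed.

(** The inverse is written with the real power, whose measurability is available; squaring makes the
    base nonnegative, and at 0 both sides are 0. *)
Lemma measurable_invr : measurable_fun [set: mR] (@GRing.inv R : mR -> mR).
Proof.
rewrite (_ : GRing.inv = (fun x => x * (x ^+ 2) `^ (- 1))); last first.
  apply/funext => x; have [->|x0] := eqVneq x 0; first by rewrite invr0 mul0r.
  rewrite powR_inv1 ?sqr_ge0// expr2 invfM mulrA divff// mul1r//.
apply: measurable_funM => //.
apply: (measurableT_comp (measurable_powR (- 1))).
exact: measurable_funX.
Qed.

Lemma measurable_gauss d (S : measurableType d) (f g : S -> mR) :
  measurable_fun [set: S] f -> measurable_fun [set: S] g ->
  measurable_fun [set: S] (fun a => gauss (f a) (g a) : mR).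
Proof.
move=> mf mg; apply: measurable_funM.
  apply: (measurableT_comp (measurable_powR (- 2^-1))).
  by apply: measurable_funM.
apply: measurableT_comp => //; apply: measurableT_comp => //.
apply: measurable_funM; first exact: measurable_funX.
by apply: (measurableT_comp measurable_invr); apply: measurable_funM.
Qed.

Lemma integral_gauss t x : 0 < t -> (\int[mu]_y (gauss t (x - y))%:E = 1)%E.
Proof.
by move=> t0; under eq_integral do rewrite gauss_normal_pdf//; rewrite integral_normal_pdf.
Qed.

(** Completing the square in [y]: the product is a Gaussian in [y], centred at the weighted mean of
    [x] and [z], times a factor free of [y]. *)
Lemma gaussM t s x y z : 0 < t -> 0 < s ->
  gauss t (x - y) * gauss s (y - z) =
  gauss (t + s) (x - z) * gauss (t * s / (t + s)) ((s * x + t * z) / (t + s) - y).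
Proof.
move=> t0 s0; have ts0 : 0 < t + s by rewrite addr_gt0.
have pi0 := @pi_gt0 R.
rewrite /gauss.
rewrite [LHS]mulrACA [RHS]mulrACA -!expRD -!powRM; last first.
- by rewrite !mulr_ge0 ?ltW.
- by rewrite !mulr_ge0 ?ltW.
- by rewrite !mulr_ge0 ?invr_ge0 ?ltW.
- by rewrite !mulr_ge0 ?ltW.
congr (_ `^ _ * expR _); first by field; rewrite gt_eqF.
by field; rewrite !gt_eqF.
Qed.

Lemma integral_gaussM t s x z : 0 < t -> 0 < s ->
  (\int[mu]_y (gauss t (x - y) * gauss s (y - z))%:E = (gauss (t + s) (x - z))%:E)%E.
Proof.
move=> t0 s0; under eq_integral do rewrite gaussM// EFinM.
rewrite ge0_integralZl//.
- rewrite integral_gauss ?mule1//.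
  by rewrite divr_gt0 ?mulr_gt0 ?addr_gt0.
- by apply/measurable_EFinP; apply: measurable_gauss => //; exact: measurable_funB.
- by move=> y _; rewrite lee_fin gauss_ge0.
- by rewrite lee_fin gauss_ge0.
Qed.

(** Dirichlet heat kernel of the half-line by the method of images. Defined for all real arguments,
    it is odd in each space variable. *)
Definition dgauss t x y := gauss t (x - y) - gauss t (x + y).

Lemma dgaussNl t x y : dgauss t (- x) y = - dgauss t x y.
Proof.
by rewrite /dgauss -opprD gaussN (_ : - x + y = - (x - y)) ?gaussN ?opprB// addrC.
Qed.

Lemma dgaussNr t x y : dgauss t x (- y) = - dgauss t x y.
Proof. by rewrite /dgauss opprK opprB. Qed.

Lemma dgaussC t x y : dgauss t x y = dgauss t y x.
Proof. by rewrite /dgauss -gaussN opprB [x + y]addrC. Qed.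

Lemma dgauss_gt0 t x y : 0 < t -> 0 < x -> 0 < y -> 0 < dgauss t x y.
Proof.
move=> t0 x0 y0; rewrite subr_gt0 ltr_pM2l; last first.
  by rewrite powR_gt0// !mulr_gt0 ?pi_gt0.
rewrite ltr_expR ltrN2 ltr_pM2r ?invr_gt0 ?mulr_gt0//.
have : 0 < x * y by rewrite mulr_gt0.
rewrite !expr2; nra.
Qed.

Lemma dgauss0 t x : dgauss t x 0 = 0.
Proof. by rewrite /dgauss addr0 subr0 subrr. Qed.

(** Both factors are odd in [y] and change sign together, so [y] may have any sign; this allows
    integration over the whole line. *)
Lemma dgaussM_ge0 t s x y z : 0 < t -> 0 < s -> 0 < x -> 0 < z ->
  0 <= dgauss t x y * dgauss s y z.
Proof.
move=> t0 s0 x0 z0; have [y0|y0|<-] := ltgtP 0 y.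
- by rewrite mulr_ge0// ltW// dgauss_gt0.
- rewrite -[y]opprK dgaussNr dgaussNl mulrNN mulr_ge0// ltW// dgauss_gt0// oppr_gt0//.
- by rewrite dgauss0 mul0r.
Qed.

Lemma continuous_gauss t : continuous (gauss t).
Proof.
move=> s; apply: cvgM; first exact: cvg_cst.
apply: (@cvg_comp _ _ _ _ expR); last exact: continuous_expR.
apply: (@cvgN _ R^o); apply: cvgM; last exact: cvg_cst.
exact: sqr_continuous.
Qed.

Lemma continuous_dgauss t x : continuous (dgauss t x).
Proof.
move=> y; apply: (@cvgB _ R^o).
- apply: (@continuous_comp _ _ _ (fun y => x - y) (gauss t)); last exact: continuous_gauss.
  by apply: (@cvgB _ R^o); [exact: cvg_cst|exact: cvg_id].
- apply: (@continuous_comp _ _ _ (fun y => x + y) (gauss t)); last exact: continuous_gauss.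
  by apply: (@cvgD _ R^o); [exact: cvg_cst|exact: cvg_id].
Qed.

Lemma measurable_dgauss d (S : measurableType d) (f g h : S -> mR) :
  measurable_fun [set: S] f -> measurable_fun [set: S] g -> measurable_fun [set: S] h ->
  measurable_fun [set: S] (fun a => dgauss (f a) (g a) (h a) : mR).
Proof.
move=> mf mg mh; apply: measurable_funB; apply: measurable_gauss => //.
- exact: measurable_funB.
- exact: measurable_funD.
Qed.

(* The integrand is even in y, so the integral over y > 0 is half the
   integral over the line, which expands into four Gaussian convolutions. *)
Lemma integral_dgaussM t s x z : 0 < t -> 0 < s -> 0 < x -> 0 < z ->
  (\int[mu]_(y in [set y | (0 <= y)%R]) (dgauss t x y * dgauss s y z)%:E =
   (dgauss (t + s) x z)%:E)%E.
Proof.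
move=> t0 s0 x0 z0.
pose P y := dgauss t x y * dgauss s y z.
(* [Q] is the opposite of the two negative cross terms of [P], so that [P + Q] and [Q] are both sums
   of Gaussian products and only nonnegative functions are integrated. *)
pose Q y := gauss t (- x - y) * gauss s (y - z) + gauss t (x - y) * gauss s (y - - z).
have mP : measurable_fun [set: mR] P by apply: measurable_funM; apply: measurable_dgauss.
have mB (c : R) : measurable_fun [set: mR] ((fun y => c - y) : mR -> mR) by exact: measurable_funB.
have mB' (c : R) : measurable_fun [set: mR] ((fun y => y - c) : mR -> mR) by exact: measurable_funB.
have mG (a b c d : R) : measurable_fun [set: mR] (fun y => gauss a (b - y) * gauss c (y - d)).
  by apply: measurable_funM; apply: measurable_gauss.
have iD (a b c d : R) : (\int[mu]_y (gauss t (a - y) * gauss s (y - b) +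
     gauss t (c - y) * gauss s (y - d))%:E =
     (gauss (t + s) (a - b) + gauss (t + s) (c - d))%:E)%E.
  under eq_integral do rewrite EFinD.
  rewrite ge0_integralD//; first by rewrite !integral_gaussM// EFinD.
  - by move=> y _; rewrite lee_fin mulr_ge0 ?gauss_ge0.
  - exact/measurable_EFinP.
  - by move=> y _; rewrite lee_fin mulr_ge0 ?gauss_ge0.
  - exact/measurable_EFinP.
have E1 : (\int[mu]_y (P y)%:E + \int[mu]_y (Q y)%:E =
    \int[mu]_y (gauss t (x - y) * gauss s (y - z) + gauss t (- x - y) * gauss s (y - - z))%:E)%E.
  rewrite -ge0_integralD//.
  - apply: eq_integral => y _; rewrite -EFinD; congr (_%:E).
    rewrite /P /Q /dgauss opprK.
    have -> : gauss t (- x - y) = gauss t (x + y) by rewrite -opprD gaussN.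
    ring.
  - by move=> y _; rewrite lee_fin dgaussM_ge0.
  - exact/measurable_EFinP.
  - by move=> y _; rewrite lee_fin addr_ge0// mulr_ge0 ?gauss_ge0.
  - by apply/measurable_EFinP; exact: measurable_funD.
have E2 : (\int[mu]_y (P y)%:E = 2%:E * \int[mu]_(y in [set y | (0 <= y)%R]) (P y)%:E)%E.
  apply: ge0_symfun_integralT.
  - by move=> y; rewrite dgaussM_ge0.
  - move=> y; apply: cvgM; first exact: continuous_dgauss.
    rewrite /continuous_at; under eq_fun do rewrite dgaussC.
    by rewrite dgaussC; exact: continuous_dgauss.
  - by move=> y; rewrite /P /= dgaussNr dgaussNl mulrNN.
move: E1; rewrite E2 iD iD.
set I := (\int[mu]_(y in _) _)%E.
have I0 : (0 <= I)%E by apply: integral_ge0 => y _; rewrite lee_fin dgaussM_ge0.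
have -> : gauss (t + s) (- x - z) = gauss (t + s) (x + z) by rewrite -opprD gaussN.
have -> : gauss (t + s) (- x - - z) = gauss (t + s) (x - z) by rewrite -opprD gaussN.
rewrite opprK /dgauss.
case: I I0 => [r| |]// _; last by rewrite mulry gtr0_sg// mul1e.
by rewrite -EFinM -EFinD => -[] h; congr (_%:E); lra.
Qed.

(** Dropping the subtracted image leaves a Gaussian of mass 1. Only an inequality holds, heat being
    lost through the boundary. *)
Lemma integral_dgauss_le1 t x : 0 < t -> 0 < x ->
  (\int[mu]_(y in [set y | (0 <= y)%R]) (dgauss t x y)%:E <= 1)%E.
Proof.
move=> t0 x0; have m0 : measurable ([set y | 0 <= y] : set mR) by rewrite -set_itvcy.
have mB (c : R) : measurable_fun [set: mR] ((fun y => c - y) : mR -> mR) by exact: measurable_funB.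
rewrite -(integral_gauss t x t0).
apply: (@le_trans _ _ (\int[mu]_(y in [set y | (0 <= y)%R]) (gauss t (x - y))%:E)%E).
  apply: ge0_le_integral => //.
  - move=> y /=; rewrite le_eqVlt => /predU1P[<-|y0]; first by rewrite dgauss0.
    by rewrite lee_fin ltW// dgauss_gt0.
  - by apply/measurable_EFinP; apply: measurable_funTS; exact: measurable_dgauss.
  - by apply/measurable_EFinP; apply: measurable_funTS; exact: measurable_gauss.
  - by move=> y _; rewrite lee_fin gerBl gauss_ge0.
apply: ge0_subset_integral => //.
- by apply/measurable_EFinP; exact: measurable_gauss.
- by move=> y _; rewrite lee_fin gauss_ge0.
Qed.

End gauss.

(** * The heat kernel of Omega_m: semigroup property and Jensen's inequality *)

Section kernel.
Context {R : realType}.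
Local Notation mR := (measurableTypeR R).
Local Notation mu := (@lebesgue_measure R).

(* Factor of the kernel of e^{t Delta_m} along a coordinate, Dirichlet when b holds;
   the cut-off makes it nonnegative and jointly measurable without side conditions. *)
Definition kfac (b : bool) (t x y : R) : R :=
  if b then if [&& 0 < t, 0 < x & 0 < y] then dgauss t x y else 0
  else gauss t (x - y).

Lemma kfac_ge0 b t x y : 0 <= kfac b t x y.
Proof.
rewrite /kfac; case: b; last exact: gauss_ge0.
by case: ifPn => // /and3P[t0 x0 y0]; rewrite ltW// dgauss_gt0.
Qed.

Lemma measurable_kfac b d (S : measurableType d) (f g h : S -> mR) :
  measurable_fun [set: S] f -> measurable_fun [set: S] g -> measurable_fun [set: S] h ->
  measurable_fun [set: S] (fun a => kfac b (f a) (g a) (h a) : mR).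
Proof.
move=> mf mg mh; rewrite /kfac; case: b; last first.
  by apply: measurable_gauss => //; exact: measurable_funB.
apply: measurable_fun_ifT => //; last exact: measurable_dgauss.
by apply: measurable_and; [|apply: measurable_and]; exact: measurable_fun_ltr.
Qed.

(** The endpoint 0 is null, which reconciles the closed half-line of the image computation with the
    strict cut-off in [kfac]. *)
Lemma integral_Rge0E (f : R -> R) : measurable_fun [set: mR] f ->
  (\int[mu]_(y in [set y | (0 <= y)%R]) (f y)%:E =
   \int[mu]_y (if 0 < y then f y else 0)%:E)%E.
Proof.
move=> mf; rewrite -set_itvcy -integral_itv_obnd_cbnd; last first.
  by apply/measurable_EFinP; exact: measurable_funTS.
rewrite integral_mkcond; apply: eq_integral => y _.
by rewrite patchE mem_setE/= in_itv/= andbT; case: ifP.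
Qed.

Lemma integral_kfacM b t s x z : 0 < t -> 0 < s ->
  (\int[mu]_y (kfac b t x y * kfac b s y z)%:E = (kfac b (t + s) x z)%:E)%E.
Proof.
move=> t0 s0; rewrite /kfac; case: b; last exact: integral_gaussM.
rewrite t0 s0 addr_gt0//=; case: (ltP 0 x) => x0 /=; last first.
  by under eq_integral do rewrite mul0r; rewrite integral0.
case: (ltP 0 z) => z0; last first.
  by under eq_integral do rewrite andbF mulr0; rewrite integral0.
rewrite -(integral_dgaussM t s x z)// integral_Rge0E; last first.
  by apply: measurable_funM; exact: measurable_dgauss.
by apply: eq_integral => y _; case: ifP => //=; rewrite ?mul0r.
Qed.

Lemma integral_kfac_le1 b t x : 0 < t ->
  (\int[mu]_y (kfac b t x y)%:E <= 1)%E.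
Proof.
move=> t0; rewrite /kfac; case: b; last by rewrite integral_gauss.
rewrite t0/=; case: (ltP 0 x) => x0 /=; last by rewrite integral0.
rewrite -integral_Rge0E; first exact: integral_dgauss_le1.
exact: measurable_dgauss.
Qed.

Context {N : nat} (m : nat).
Local Notation leb := (lebesgue_rV R N).
Local Notation vec := 'rV[R]_N.

Definition kern (t : R) (x y : vec) : R :=
  \prod_(i < N) kfac (i < m)%N t (x ord0 i) (y ord0 i).

Lemma kern_ge0 t x y : 0 <= kern t x y.
Proof. by apply: prodr_ge0 => i _; exact: kfac_ge0. Qed.

Lemma measurable_coorT d (S : measurableType d) (f : S -> vec) i :
  measurable_fun [set: S] f -> measurable_fun [set: S] (fun a => f a ord0 i : mR).
Proof. by move=> mf; apply: (measurableT_comp (measurable_coor (T := R) i)). Qed.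

Lemma measurable_kern d (S : measurableType d) (f : S -> mR) (g h : S -> vec) :
  measurable_fun [set: S] f -> measurable_fun [set: S] g -> measurable_fun [set: S] h ->
  measurable_fun [set: S] (fun a => kern (f a) (g a) (h a) : mR).
Proof.
move=> mf mg mh; apply: measurable_prod => i _.
by apply: measurable_kfac => //; exact: measurable_coorT.
Qed.

Lemma measurable_kernr t x : measurable_fun [set: vec] (kern t x : vec -> mR).
Proof. exact: measurable_kern. Qed.

Lemma kernE t x y : 0 < t -> Omega m x -> Omega m y ->
  kern t x y = heat_kernel m t x y.
Proof.
move=> t0 xO yO; apply: eq_bigr => i _; rewrite /kfac.
by case: ifPn => // im; rewrite t0 xO// yO.
Qed.

Lemma kern_eq0 t x y : ~ Omega m y -> kern t x y = 0.
Proof.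
move=> /existsNP[i /not_implyP[im /negP yi]].
by rewrite /kern (bigD1 i)//= /kfac im (negPf yi) !andbF mul0r.
Qed.

Lemma kern_gt0 t x y : 0 < t -> Omega m x -> Omega m y -> 0 < kern t x y.
Proof.
move=> t0 xO yO; apply: prodr_gt0 => i _; rewrite /kfac; case: ifPn => im.
  by rewrite t0 xO ?yO//=; exact: dgauss_gt0 t0 (xO _ im) (yO _ im).
exact: gauss_gt0.
Qed.

Lemma integral_kernM t s x z : 0 < t -> 0 < s ->
  (\int[leb]_y (kern t x y * kern s y z)%:E = (kern (t + s) x z)%:E)%E.
Proof.
move=> t0 s0; under eq_integral do rewrite -big_split/=.
rewrite (ge0_integral_prod N (fun i a => kfac (i < m)%N t (x ord0 i) a *
  kfac (i < m)%N s a (z ord0 i))).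
- under eq_bigr do rewrite integral_kfacM//.
  by rewrite prodEFin.
- by move=> i; apply: measurable_funM; exact: measurable_kfac.
- by move=> i a; rewrite mulr_ge0// kfac_ge0.
Qed.

Lemma integral_kern_le1 t x : 0 < t -> (\int[leb]_y (kern t x y)%:E <= 1)%E.
Proof.
move=> t0; rewrite (ge0_integral_prod N (fun i a => kfac (i < m)%N t (x ord0 i) a)).
(* Nonnegativity is carried along because multiplying upper bounds in the extended reals requires
   it. *)
- suff /andP[] : (0 <= \prod_(i < N) \int[mu]_a (kfac (i < m)%N t (x ord0 i) a)%:E <= 1)%E.
    by [].
  elim/big_ind : _ => [|y z /andP[y0 y1] /andP[z0 z1]|i _].
  + by rewrite lee01 lexx.
  + by rewrite mule_ge0//= -[leRHS]mule1 lee_pmul.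
  + rewrite integral_kfac_le1// andbT.
    by apply: integral_ge0 => a _; rewrite lee_fin kfac_ge0.
- by move=> i; exact: measurable_kfac.
- by move=> i a; exact: kfac_ge0.
Qed.

Local Open Scope ereal_scope.

(* The integral over all of R^N, equal to heat on Omega m, of extended-real data. *)
Definition dheat (t : R) (f : vec -> \bar R) (x : vec) : \bar R :=
  \int[leb]_y ((kern t x y)%:E * f y).

Lemma heat_dheat t f x : (0 < t)%R -> Omega m x ->
  heat m t f x = dheat t (EFin \o f) x.
Proof.
move=> t0 xO; rewrite /heat integral_mkcond; apply: eq_integral => y _.
rewrite patchE; case: ifPn => [/set_mem yO|/negP yO].
  by rewrite -EFinM kernE.
by rewrite kern_eq0 ?mul0e// => /mem_set.
Qed.

Lemma dheat_ge0 t f x : (forall y, 0 <= f y) -> 0 <= dheat t f x.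
Proof.
by move=> f0; apply: integral_ge0 => y _; rewrite mule_ge0// lee_fin kern_ge0.
Qed.

(** Tonelli and the Chapman-Kolmogorov identity [integral_kernM]; infinite values of [f] or of the
    integrals do no harm. *)
Lemma dheat_semigroup t s f x : (0 < t)%R -> (0 < s)%R ->
  measurable_fun [set: vec] f -> (forall y, 0 <= f y) ->
  dheat t (dheat s f) x = dheat (t + s)%R f x.
Proof.
move=> t0 s0 mf f0; rewrite /dheat.
pose F (p : vec * vec) := (kern t x p.1)%:E * ((kern s p.1 p.2)%:E * f p.2).
have F0 p : 0 <= F p by rewrite /F !mule_ge0// lee_fin kern_ge0.
have mF : measurable_fun [set: vec * vec] F.
  apply: emeasurable_funM.
    apply/measurable_EFinP; apply: measurable_kern => //.
  apply: emeasurable_funM.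
    by apply/measurable_EFinP; apply: measurable_kern.
  by apply: (measurableT_comp mf).
transitivity (\int[leb]_y \int[leb]_z F (y, z)).
  apply: eq_integral => y _; rewrite -ge0_integralZl//.
  - apply: emeasurable_funM => //; apply/measurable_EFinP; exact: measurable_kernr.
  - by move=> z _; rewrite mule_ge0// lee_fin kern_ge0.
  - by rewrite lee_fin kern_ge0.
rewrite (fubini_tonelli F)//; apply: eq_integral => z _.
rewrite -integral_kernM// -ge0_integralZr//.
- by apply: eq_integral => y _; rewrite /F/= muleA EFinM.
- apply/measurable_EFinP; apply: measurable_funM; exact: measurable_kern.
- by move=> y _; rewrite lee_fin mulr_ge0// kern_ge0.
Qed.

(** The convex function r^{1+a} lies above its tangent at [b]; the negative constant term is moved
    to the right so that every term is nonnegative and can be integrated. *)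
Lemma le_powR_tangent (a r b : R) : (0 < a)%R -> (0 <= r)%R -> (0 <= b)%R ->
  ((1 + a) * (b `^ a * r) <= r `^ (1 + a) + a * b `^ (1 + a))%R.
Proof.
move=> a0; rewrite le_eqVlt => /predU1P[<- b0|r0].
  by rewrite !mulr0 addr_ge0 ?mulr_ge0 ?powR_ge0// ltW.
rewrite le_eqVlt => /predU1P[<-|b0].
  by rewrite !powR0 ?gt_eqF ?addr_gt0// mul0r !mulr0 addr0 powR_ge0.
have h (c : R) : (0 < c)%R -> (c `^ (1 + a) = c * c `^ a)%R.
  move=> c0; rewrite powRD; last by rewrite (gt_eqF c0) implybT.
  by rewrite powRr1// ltW.
rewrite !h//.
(* With q = r/b this reads 1 + a (1 - 1/q) <= q^a, which follows from e^x >= 1 + x and ln q >= 1 -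
   1/q. *)
suff : (b `^ a * (r + a * (r - b)) <= r * r `^ a)%R by nra.
have -> : (r `^ a = b `^ a * (r / b) `^ a)%R.
  by rewrite -powRM ?divr_ge0 ?ltW// mulrCA divff ?gt_eqF// mulr1.
rewrite mulrCA ler_pM2l ?powR_gt0//.
have -> : (r + a * (r - b) = r * (1 + a * (1 - (r / b)^-1)))%R.
  by field; rewrite !gt_eqF.
rewrite ler_pM2l// /powR gt_eqF ?divr_gt0//.
apply: le_trans (expR_ge1Dx _); rewrite lerD2l ler_pM2l//.
have q0 : (0 < (r / b)^-1)%R by rewrite invr_gt0 divr_gt0.
have : (ln (1 + ((r / b)^-1 - 1)) <= (r / b)^-1 - 1)%R.
  by apply: le_ln1Dx; rewrite ltrBrDl subrr.
by rewrite addrC subrK lnV ?posrE ?divr_gt0//; lra.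
Qed.

(** The tangent inequality at the mean value [b] is integrated against the kernel. Mass at most 1
    suffices, since the mass multiplies only the term a b^{1+a} on the larger side. *)
Lemma dheat_jensen t (f : vec -> R) (a b : R) x : (0 < t)%R -> (0 < a)%R ->
  measurable_fun [set: vec] (f : vec -> mR) -> (forall y, (0 <= f y)%R) ->
  dheat t (EFin \o f) x = b%:E ->
  (b `^ (1 + a))%:E <= dheat t (fun y => (f y `^ (1 + a))%:E) x.
Proof.
move=> t0 a_gt0 mf f0 hb; have a0 := ltW a_gt0.
have b0 : (0 <= b)%R by rewrite -lee_fin -hb; apply: dheat_ge0 => y; rewrite lee_fin.
have mk := measurable_kernr t x.
have mp : measurable_fun [set: vec] (fun y => (f y `^ (1 + a))%R : mR).
  by apply: (measurableT_comp (measurable_powR (1 + a))).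
(* The finite term a b^{1+a} cancels even if the integral on the right is infinite. *)
suff : ((1 + a) * b `^ (1 + a))%:E <=
    dheat t (fun y => (f y `^ (1 + a))%:E) x + (a * b `^ (1 + a))%:E.
  have : 0 <= dheat t (fun y => (f y `^ (1 + a))%:E) x.
    by apply: dheat_ge0 => y; rewrite lee_fin powR_ge0.
  case: (dheat _ _ x) => [r _|_ _|]; first by rewrite -EFinD !lee_fin; lra.
  - by rewrite leey.
  - by rewrite leeNy_eq.
apply: (@le_trans _ _ (dheat t (fun y => (f y `^ (1 + a))%:E) x +
    \int[leb]_y ((a * b `^ (1 + a))%:E * (kern t x y)%:E))); last first.
  rewrite leeD2l// ge0_integralZl//.
  - rewrite -[leRHS]mule1 lee_wpmul2l// ?integral_kern_le1//.
    by rewrite lee_fin mulr_ge0// powR_ge0.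
  - exact/measurable_EFinP.
  - by move=> y _; rewrite lee_fin kern_ge0.
  - by rewrite lee_fin mulr_ge0// powR_ge0.
rewrite /dheat -ge0_integralD//; first last.
- by apply: emeasurable_funM => //; exact/measurable_EFinP.
- by move=> y _; rewrite mule_ge0// lee_fin ?kern_ge0// mulr_ge0// powR_ge0.
- by apply: emeasurable_funM; exact/measurable_EFinP.
- by move=> y _; rewrite mule_ge0// lee_fin ?kern_ge0// powR_ge0.
have -> : ((1 + a) * b `^ (1 + a))%:E =
    \int[leb]_y (((1 + a) * b `^ a)%:E * ((kern t x y)%:E * (f y)%:E)).
  rewrite ge0_integralZl//.
  - rewrite -[\int[_]_ _ _]/(dheat t (EFin \o f) x) hb -EFinM; congr (_%:E).
    rewrite -mulrA; congr (_ * _)%R.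
    have [->|bn] := eqVneq b 0%R; first by rewrite powR0 ?mulr0// gt_eqF; lra.
    by rewrite powRD ?bn ?implybT// powRr1// mulrC.
  - by apply: emeasurable_funM; exact/measurable_EFinP.
  - by move=> y _; apply: mule_ge0; rewrite lee_fin ?kern_ge0 ?f0.
  - by rewrite lee_fin mulr_ge0 ?powR_ge0//; lra.
apply: ge0_le_integral => //.
- move=> y _; apply: mule_ge0; first by rewrite lee_fin mulr_ge0 ?powR_ge0//; lra.
  by apply: mule_ge0; rewrite lee_fin ?kern_ge0 ?f0.
- by do 2 apply: emeasurable_funM => //; exact/measurable_EFinP.
- apply: emeasurable_funD; apply: emeasurable_funM => //; exact/measurable_EFinP.
- move=> y _; rewrite -!EFinM -EFinD lee_fin.
  have := ler_wpM2l (kern_ge0 t x y) (le_powR_tangent a (f y) b a_gt0 (f0 y) b0).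
  by rewrite !mulrDr; lra.
Qed.

End kernel.

(** * Joint measurability in time and space of a continuous curve of continuous functions *)

Section joint_measurability.
Context {R : realType}.
Local Notation mR := (measurableTypeR R).

(** A preimage is a countable union of fibres of [g], so nothing is asked of [h]. *)
Lemma measurable_fun_countable d d' (S : measurableType d) (C : countType)
    (V : measurableType d') (g : S -> C) (h : C -> V) :
  (forall c, measurable (g @^-1` [set c])) -> measurable_fun [set: S] (h \o g).
Proof.
move=> mg _ Y mY; rewrite setTI.
have -> : (h \o g) @^-1` Y = \bigcup_(c in [set c | Y (h c)]) (g @^-1` [set c]).
  apply/seteqP; split => x /=; first by move=> hx; exists (g x).
  by move=> [c /= Yc ->].
rewrite bigcup_mkcond; apply: countable_bigcupT_measurable; first exact: countableP.
by move=> c; case: ifP.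
Qed.

(** [grid n (cell n x)] rounds [x] down to a multiple of 1/(n+1). The integer label is kept apart
    from the value so that the rounding factors through a countable type. *)
Definition grid (n : nat) (z : int) : R := z%:~R / n.+1%:R.
Definition cell (n : nat) (x : R) : int := Num.floor (n.+1%:R * x).

Lemma grid_cell n x : `|x - grid n (cell n x)| < 2 / n.+1%:R.
Proof.
have n0 : (0 : R) < n.+1%:R by [].
have xE : x = (n.+1%:R * x) / n.+1%:R by rewrite mulrC mulKf ?gt_eqF.
rewrite /grid /cell {1}xE -mulrBl normrM (ger0_norm (_ : 0 <= n.+1%:R^-1))//.
rewrite ltr_pM2r ?invr_gt0//.
have /andP[h1 h2] := floor_itv (n.+1%:R * x).
by rewrite ger0_norm ?subr_ge0//; move: h2; rewrite intrD/=; lra.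
Qed.

Lemma measurable_cell d (S : measurableType d) n (f : S -> mR) (c : int) :
  measurable_fun [set: S] f -> measurable [set a | cell n (f a) = c].
Proof.
move=> mf; have mnf : measurable_fun [set: S] (fun a => n.+1%:R * f a : mR).
  exact: measurable_funM.
rewrite (_ : [set _ | _] = (fun a => n.+1%:R * f a) @^-1` `[c%:~R, (c + 1)%:~R[%classic).
  rewrite -[X in measurable X]setTI; apply: mnf => //; exact: measurable_itv.
apply/seteqP; split => a /=; rewrite in_itv/=.
  by move=> <-; exact: floor_itv.
by move=> h; exact: floor_def.
Qed.

Lemma nbhs_uniform (T : choiceType) (u : R -> T -> R) (s e : R) : 0 < e ->
  {uniform, u @ s --> u s} -> \forall r \near s, forall y, `|u s y - u r y| < e.
Proof.
move=> e0 hu.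
apply: (hu [set h : T -> R | forall y, `|u s y - h y| < e]).
apply/uniform_nbhs; exists [set p : R * R | `|p.1 - p.2| < e]; split.
  exact: (entourage_ball R (PosNum e0)).
by move=> h /= hh y; apply: hh.
Qed.

Lemma nbhs_cell (s : R) (P : set R) : nbhs s P -> \forall n \near \oo, P (grid n (cell n s)).
Proof.
move=> /nbhs_ballP[e /= e0 hP]; near=> n; apply: hP; rewrite /ball/=.
apply: lt_trans (grid_cell n s) _.
rewrite mulrC -ltr_pdivlMr//.
near: n; exact: near_infty_natSinv_lt (PosNum (divr_gt0 e0 (ltr0n R 2))).
Unshelve. all: by end_near. Qed.

Variable N : nat.
Local Notation vec := 'rV[R]_N.

Definition vgrid (n : nat) (z : 'rV[int]_N) : vec := \row_i grid n (z ord0 i).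
Definition vcell (n : nat) (x : vec) : 'rV[int]_N := \row_i cell n (x ord0 i).

Lemma nbhs_vcell (x : vec) (P : set vec) :
  nbhs x P -> \forall n \near \oo, P (vgrid n (vcell n x)).
Proof.
move=> /nbhs_ballP[e /= e0 hP]; near=> n; apply: hP; split => // i j.
rewrite /ball/= !mxE (ord1 i).
apply: lt_trans (grid_cell n _) _.
rewrite mulrC -ltr_pdivlMr//.
near: n; exact: near_infty_natSinv_lt (PosNum (divr_gt0 e0 (ltr0n R 2))).
Unshelve. all: by end_near. Qed.

(* u is the pointwise limit of its compositions with the roundings to the grids
   of mesh 1/(n+1), which have countable range. *)
Lemma measurable_continuous_curve (t : R) (u : R -> vec -> R) :
  (forall s, 0 < s < t -> continuous (u s)) ->
  (forall s, 0 < s < t -> {uniform, u @ s --> u s}) ->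
  measurable_fun [set: mR * vec]
    (fun p => if 0 < p.1 < t then u p.1 p.2 else 0 : mR).
Proof.
move=> cu uu.
(* The test is on the exact time: the rounded time may leave the interval, where [u] is arbitrary,
   but for a fixed [s] it is eventually close to [s]. *)
pose h (n : nat) (p : mR * vec) : mR :=
  if 0 < p.1 < t then u (grid n (cell n p.1)) (vgrid n (vcell n p.2)) else 0.
apply: (@measurable_fun_cvg _ _ _ _ h).
- move=> n; apply: measurable_fun_ifT => //.
    by apply: measurable_and; exact: measurable_fun_ltr.
  apply: (@measurable_fun_countable _ _ _ (int * 'rV[int]_N)%type _
    (fun p : mR * vec => (cell n p.1, vcell n p.2)) (fun c => u (grid n c.1) (vgrid n c.2))).
  move=> [c v].
  rewrite [X in measurable X](_ : _ = [set p : mR * vec | cell n p.1 = c] `&`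
     \bigcap_(i in [set: 'I_N]) [set p : mR * vec | cell n (p.2 ord0 i) = v ord0 i]).
    apply: measurableI; first exact: measurable_cell.
    apply: fin_bigcap_measurable => // i _; apply: measurable_cell.
    exact: measurable_coorT.
  apply/seteqP; split => -[s x] /=.
    by move=> [-> <-]; split => // i _ /=; rewrite mxE.
  move=> [-> hv]; congr (_, _); apply/rowP => i; rewrite mxE; exact: hv.
- move=> [s x] _; rewrite /h /=; case: ifPn => // st; last exact: cvg_cst.
  apply/cvgrPdist_lt => e e0.
  have e20 : 0 < e / 2 by rewrite divr_gt0.
  near=> n.
  (* The first half is continuity of [u s]. The second compares two times at a point that moves with
     [n], hence the need for uniform convergence in space. *)
  rewrite (splitr e) -[u s x](subrK (u s (vgrid n (vcell n x)))) -addrA.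
  apply: le_lt_trans (ler_normD _ _) _; apply: ltrD.
    near: n; apply: (@nbhs_vcell x [set y | `|u s x - u s y| < e / 2]).
    by have /cvgrPdist_lt := cu s st x; apply.
  near: n.
  have := @nbhs_cell s _ (nbhs_uniform _ _ _ _ e20 (uu s st)).
  by apply: filterS => n /(_ (vgrid n (vcell n x))).
Unshelve. all: by end_near. Qed.

End joint_measurability.

(** * A discrete comparison with y' = y^{1+a} *)

Section blowup.
Context {R : realType}.

Lemma powR_ge_ln (q b : R) : 0 < q -> 1 + b * ln q <= q `^ b.
Proof. by move=> q0; rewrite /powR gt_eqF// expR_ge1Dx. Qed.

Lemma gt0_ler_powR (a X Y : R) : 0 < a -> 0 < X -> X <= Y -> X `^ a <= Y `^ a.
Proof.
move=> a0 X0 XY; apply: ge0_ler_powR => //; rewrite ?nnegrE; apply: ltW => //.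
exact: lt_le_trans XY.
Qed.

(** Along y' = y^{1+a} the quantity y^{-a} decreases at the constant rate a. One Euler step
    reproduces this up to the relative error (1+a) h M^a, through 1 - q^{-a} >= a (q-1) q^{-1-a} and
    q^{-1-a} >= 1 - (1+a)(q-1). *)
Lemma euler_step (a M h X Y : R) : 0 < a -> 0 < h -> 0 < X -> X <= M ->
  X + h * X `^ (1 + a) <= Y ->
  a * h * (1 - (1 + a) * (h * M `^ a)) <= X `^ (- a) - Y `^ (- a).
Proof.
move=> a0 h0 X0 XM.
have Xa0 : 0 < X `^ a by rewrite powR_gt0.
have -> : X `^ (1 + a) = X * X `^ a.
  by rewrite powRD ?(gt_eqF X0) ?implybT// powRr1// ltW.
(* The factor by which one Euler step multiplies [X]. *)
pose q := 1 + h * X `^ a.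
have q1 : 0 < q - 1 by rewrite /q addrAC subrr add0r mulr_gt0.
have q0 : 0 < q by lra.
have -> : X + h * (X * X `^ a) = X * q by rewrite /q; ring.
move=> XqY.
have Y0 : 0 < Y by apply: lt_le_trans XqY; rewrite mulr_gt0.
have : Y `^ (- a) <= X `^ (- a) * q `^ (- a).
  rewrite -(powRM _ (ltW X0) (ltW q0)) !powRN lef_pV2 ?posrE ?powR_gt0 ?mulr_gt0//.
  by apply: gt0_ler_powR => //; rewrite mulr_gt0.
have lnq : ln q <= q - 1.
  have := @le_ln1Dx R (q - 1); rewrite [1 + _]addrC subrK; apply; lra.
have lnq' : (q - 1) / q <= ln q.
  have : ln q^-1 <= q^-1 - 1.
    have := @le_ln1Dx R (q^-1 - 1); rewrite [1 + _]addrC subrK; apply.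
    by rewrite ltrBrDl subrr invr_gt0.
  by rewrite lnV ?posrE// mulrBl divff ?gt_eqF// mul1r; lra.
have h1 : a * (q - 1) * q `^ (- (1 + a)) <= 1 - q `^ (- a).
  have : q `^ (- a) * (1 + a * ((q - 1) / q)) <= q `^ (- a) * q `^ a.
    rewrite ler_pM2l ?powR_gt0//; apply: le_trans (powR_ge_ln q a q0).
    by rewrite lerD2l ler_pM2l.
  rewrite -powRD ?(gt_eqF q0) ?implybT// addNr powRr0.
  have -> : q `^ (- (1 + a)) = q `^ (- a) / q.
    rewrite opprD addrC powRD ?(gt_eqF q0) ?implybT//; congr (_ * _).
    by rewrite powR_inv1// ltW.
  by rewrite mulrDr mulr1 [a * (q - 1) * _]mulrC !mulrA; lra.
have h2 : 1 - (1 + a) * (q - 1) <= q `^ (- (1 + a)).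
  apply: le_trans (powR_ge_ln _ _ q0); rewrite mulNr lerD2l lerN2 ler_pM2l//.
  by rewrite addr_gt0.
have h3 : a * (q - 1) * (1 - (1 + a) * (q - 1)) <= 1 - q `^ (- a).
  by apply: le_trans h1; rewrite ler_pM2l// mulr_gt0.
have qh : q - 1 = h * X `^ a by rewrite /q addrAC subrr add0r.
have : X `^ (- a) * (a * (q - 1) * (1 - (1 + a) * (q - 1))) <=
       X `^ (- a) * (1 - q `^ (- a)).
  by rewrite ler_pM2l ?powR_gt0.
rewrite {1}qh.
have -> : X `^ (- a) * (a * (h * X `^ a) * (1 - (1 + a) * (q - 1))) =
    a * h * (1 - (1 + a) * (q - 1)).
  by rewrite powRN; field; rewrite gt_eqF.
have : a * h * (1 - (1 + a) * (h * M `^ a)) <= a * h * (1 - (1 + a) * (q - 1)).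
  rewrite ler_pM2l ?mulr_gt0// lerD2l lerN2 ler_pM2l ?addr_gt0// qh ler_pM2l//.
  exact: gt0_ler_powR.
by rewrite [in X in _ -> X -> _]mulrBr mulr1; lra.
Qed.

(** Since phi^{-a} starts at most at A^{-a}, loses a per unit of time and stays nonnegative, it
    cannot last longer than A^{-a}/a. The increments make [phi] monotone, and no continuity is
    used. *)
Lemma euler_blowup (a t A : R) (phi : R -> R) : 0 < a -> 0 < t -> 0 < A ->
  (forall s, 0 < s < t -> A <= phi s) ->
  (forall s1 s2, 0 < s1 -> s1 < s2 -> s2 < t ->
     phi s1 + (s2 - s1) * phi s1 `^ (1 + a) <= phi s2) ->
  a * t * A `^ a <= 1.
Proof.
move=> a0 t0 A0 hA hE.
have Ap s : 0 < s < t -> 0 < phi s by move=> /hA; exact: lt_le_trans.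
have mono s1 s2 : 0 < s1 -> s1 <= s2 -> s2 < t -> phi s1 <= phi s2.
  move=> s10; rewrite le_eqVlt => /predU1P[->//|s12 s2t].
  apply: le_trans (hE _ _ s10 s12 s2t); rewrite lerDl mulr_ge0 ?powR_ge0//.
  by rewrite subr_ge0 ltW.
(* Staying away from [t] gives the bound [M] = phi(c) on all of [b, c] by monotonicity, so that the
   errors of the Euler steps are uniform and the steps telescope. *)
have key b c : 0 < b -> b < c -> c < t -> a * (c - b) <= A `^ (- a).
  move=> b0 bc ct; pose M := phi c.
  have c0 : 0 < c by exact: lt_trans bc.
  have Mp : 0 < M by apply: Ap; rewrite c0.
  have step (h : R) n k : 0 < h -> n.+1%:R * h = c - b -> (k <= n.+1)%N ->
      k%:R * (a * h * (1 - (1 + a) * (h * M `^ a))) <=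
      phi b `^ (- a) - phi (b + k%:R * h) `^ (- a).
    move=> h0 hn; elim: k => [|k IH] kn; first by rewrite !mul0r addr0 subrr.
    have ck : b + k.+1%:R * h <= c.
      by rewrite -lerBrDl -hn ler_pM2r// ler_nat.
    have kS : k.+1%:R * h = k%:R * h + h by rewrite -natr1 mulrDl mul1r.
    have bk : 0 < b + k%:R * h.
      by rewrite (lt_le_trans b0)// lerDl mulr_ge0// ltW.
    have ckt : b + k.+1%:R * h < t by exact: le_lt_trans ck ct.
    have st := euler_step a M h (phi (b + k%:R * h)) (phi (b + k.+1%:R * h)) a0 h0.
    have lt1 : b + k%:R * h < b + k.+1%:R * h by rewrite kS addrA ltrDl.
    have := IH (ltnW kn).
    have : a * h * (1 - (1 + a) * (h * M `^ a)) <=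
      phi (b + k%:R * h) `^ (- a) - phi (b + k.+1%:R * h) `^ (- a).
      apply: st.
      - by apply: Ap; rewrite bk/=; exact: lt_trans ckt.
      - by apply: mono => //; exact: le_trans (ltW lt1) ck.
      - have := hE _ _ bk lt1 ckt.
        by rewrite (_ : b + k.+1%:R * h - (b + k%:R * h) = h)// kS; ring.
    by rewrite -natr1 mulrDl mul1r; lra.
  rewrite leNgt; apply/negP => lt.
  pose d := a * (c - b) - A `^ (- a).
  have d0 : 0 < d by rewrite subr_gt0.
  (* [K / n.+1] is the total error of n+1 equal steps from [b] to [c]; it is made smaller than the
     supposed excess [d]. *)
  pose K := a * (c - b) * ((1 + a) * ((c - b) * M `^ a)).
  have K0 : 0 < K.
    by rewrite !mulr_gt0 ?powR_gt0 ?subr_gt0 ?addr_gt0.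
  have [n hn] : exists n : nat, K / n.+1%:R < d.
    exists (Num.truncn (K / d)).
    rewrite ltr_pdivrMr// mulrC -ltr_pdivrMr//.
    by have /andP[] := truncn_itv (ltW (divr_gt0 K0 d0)).
  have := step ((c - b) / n.+1%:R) n n.+1.
  rewrite divr_gt0 ?subr_gt0// => /(_ isT).
  rewrite [X in (X = _ -> _)%type]mulrC divfK// => /(_ erefl (leqnn _)).
  have -> : n.+1%:R * (a * ((c - b) / n.+1%:R) *
      (1 - (1 + a) * ((c - b) / n.+1%:R * M `^ a))) = a * (c - b) - K / n.+1%:R.
    rewrite /K; have : n.+1%:R != 0 :> R by rewrite pnatr_eq0.
    by move: (n.+1%:R : R) => y y0; field.
  have : phi b `^ (- a) <= A `^ (- a).
    rewrite !powRN lef_pV2 ?posrE ?powR_gt0//; last first.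
      by apply: Ap; rewrite b0 (lt_trans bc).
    by apply: gt0_ler_powR => //; apply: hA; rewrite b0 (lt_trans bc).
  have := powR_ge0 (phi (b + n.+1%:R * ((c - b) / n.+1%:R))) (- a).
  move: hn; rewrite /d; move: (K / _) (A `^ _) (phi b `^ _) (phi _ `^ _) (a * _).
  by move=> *; lra.
have Aa0 : 0 < A `^ a by rewrite powR_gt0.
suff : a * t <= A `^ (- a) by move=> h; rewrite -ler_pdivlMr// div1r -powRN.
rewrite leNgt; apply/negP => lt.
(* The blow-up time of y' = y^{1+a}, y(0) = A. If it were below [t], trimming (t-c)/3 at both ends
   of (0, t) would leave length c + (t-c)/3, too long for [key]. *)
pose c := A `^ (- a) / a.
have c0 : 0 < c by rewrite divr_gt0 ?powR_gt0.
have ct : c < t by rewrite ltr_pdivrMr// mulrC.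
have := key ((t - c) / 3) (t - (t - c) / 3).
have -> : a * (t - (t - c) / 3 - (t - c) / 3) = A `^ (- a) + a * ((t - c) / 3).
  by rewrite /c; field; rewrite gt_eqF.
have : 0 < a * ((t - c) / 3) by rewrite mulr_gt0// divr_gt0// subr_gt0.
move=> d0 /(_ _ _ _); rewrite -[X in _ <= X]addr0 lerD2l.
have e1 : 0 < (t - c) / 3 by lra.
have e2 : (t - c) / 3 < t - (t - c) / 3 by lra.
have e3 : t - (t - c) / 3 < t by lra.
by move=> /(_ e1 e2 e3); lra.
Qed.

End blowup.

(** * The necessary condition alpha t A^alpha <= 1 for a mild solution *)

Section lifespan_bound.
Context {R : realType} {N : nat}.
Local Notation mR := (measurableTypeR R).
Local Notation mu := (@lebesgue_measure R).
Local Notation leb := (lebesgue_rV R N).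
Local Notation vec := 'rV[R]_N.
Local Open Scope ereal_scope.

Lemma eq_dheat m t (f g : vec -> \bar R) x : (forall y, Omega m y -> f y = g y) ->
  dheat m t f x = dheat m t g x.
Proof.
move=> fg; apply: eq_integral => y _; have [/fg ->//|yO] := pselect (Omega m y).
by rewrite kern_eq0// !mul0e.
Qed.

Lemma measurable_dheat_curve m (t : R) (G : mR * vec -> \bar R) :
  measurable_fun [set: mR * vec] G -> (forall p, 0 <= G p) ->
  measurable_fun [set: mR * vec] (fun p => dheat m (t - p.1) (fun y => G (p.1, y)) p.2).
Proof.
move=> mG G0.
apply: (@measurable_fun_fubini_tonelli_F _ _ _ _ _ leb
  (fun q : (mR * vec) * vec => (kern m (t - q.1.1) q.1.2 q.2)%:E * G (q.1.1, q.2))).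
  apply: emeasurable_funM.
    apply/measurable_EFinP; apply: measurable_kern => //.
    - apply: measurable_funB => //.
      exact: (measurableT_comp measurable_fst measurable_fst).
    - exact: (measurableT_comp measurable_snd measurable_fst).
  apply: (measurableT_comp mG); apply/measurable_fun_pairP; split; last exact: measurable_snd.
  exact: (measurableT_comp measurable_fst measurable_fst).
by move=> q; apply: mule_ge0 => //; rewrite lee_fin kern_ge0.
Qed.

(** [U0] is an everywhere nonnegative Borel substitute for [u0] with the same heat flow in Omega_m.
    Finiteness of [A] comes from Duhamel's formula at time [t], which bounds it by [u t x]. *)
Lemma mild_solution_bound m alpha (u0 U0 : vec -> R) T u t x :
  (0 < alpha)%R -> mild_solution m alpha u0 T u ->
  measurable_fun [set: vec] (U0 : vec -> mR) -> (forall y, (0 <= U0 y)%R) ->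
  (forall s y, (0 < s)%R -> Omega m y -> heat m s u0 y = dheat m s (EFin \o U0) y) ->
  (0 < t)%R -> t%:E < T -> Omega m x ->
  exists2 A, dheat m t (EFin \o U0) x = A%:E & (alpha * t * A `^ alpha <= 1)%R.
Proof.
move=> a0 sol mU0 U0_ge0 heatU t0 tT xO.
have sT s : (s <= t)%R -> s%:E < T by move=> st; apply: le_lt_trans tT; rewrite lee_fin.
(* The absolute value is needed because [u] may be negative outside Omega_m, where the kernel
   vanishes; inside, [V] is [u]. *)
pose V (p : mR * vec) : mR := `|if (0 < p.1 < t)%R then u p.1 p.2 else 0|%R.
have V0 p : (0 <= V p)%R by exact: normr_ge0.
have mV : measurable_fun [set: mR * vec] V.
  apply: measurableT_comp => //; apply: measurable_continuous_curve.
  - by move=> s /andP[s0 st]; case: (sol_C0 sol s0 (sT _ (ltW st))).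
  - by move=> s /andP[s0 st]; exact: (sol_continuous sol s0 (sT _ (ltW st))).
pose G (p : mR * vec) : \bar R := (V p `^ (1 + alpha))%:E.
have G0 p : 0 <= G p by rewrite lee_fin powR_ge0.
have mG : measurable_fun [set: mR * vec] G.
  by apply/measurable_EFinP; apply: (measurableT_comp (measurable_powR (1 + alpha))).
have VE s y : (0 < s)%R -> (s < t)%R -> Omega m y -> V (s, y) = u s y.
  move=> s0 st yO; rewrite /V/= s0 st/= ger0_norm//.
  by apply: (sol_ge0 sol s0 (sT _ (ltW st))).
have duhamel s y : (0 < s)%R -> (s <= t)%R -> Omega m y ->
    (u s y)%:E = dheat m s (EFin \o U0) y +
      \int[mu]_(r in `]0%R, s[) dheat m (s - r) (fun z => G (r, z)) y.
  move=> s0 st yO; rewrite (sol_duhamel sol s0 (sT _ st) yO) (heatU s y s0 yO); congr (_ + _).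
  apply: eq_integral => r; rewrite inE/= in_itv/= => /andP[r0 rs].
  rewrite heat_dheat ?subr_gt0//; apply: eq_dheat => z zO /=.
  have rt : (r < t)%R by exact: lt_le_trans st.
  have ur : (0 <= u r z)%R by apply: (sol_ge0 sol r0 (sT _ (ltW rt))).
  rewrite /G VE// ger0_norm//; congr (_%:E).
  have [->|un] := eqVneq (u r z) 0%R; first by rewrite mulr0 powR0// gt_eqF// addr_gt0.
  by rewrite powRD ?un ?implybT// powRr1// mulrC.
pose H (r : mR) := dheat m (t - r) (fun z => G (r, z)) x.
have H0 r : 0 <= H r by exact: dheat_ge0.
have mH : measurable_fun [set: mR] H.
  exact: (measurableT_comp (measurable_dheat_curve m t G mG G0) (measurable_pair2 x)).
have mI (s : R) : measurable (`]0%R, s[%classic : set mR) by exact: measurable_itv.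
(* Taking the integrated formula as the definition makes monotonicity and the value at s = t
   immediate; [hV] then identifies it with the heat flow of u(s) over the time t - s. *)
pose Phi (s : R) := dheat m t (EFin \o U0) x + \int[mu]_(r in `]0%R, s[) H r.
have U0' y : 0 <= (EFin \o U0) y by rewrite lee_fin.
have mU0' : measurable_fun [set: vec] (EFin \o U0) by exact/measurable_EFinP.
have hV s : (0 < s)%R -> (s < t)%R -> dheat m (t - s) (fun y => (V (s, y))%:E) x = Phi s.
  move=> s0 st; have ts0 : (0 < t - s)%R by rewrite subr_gt0.
  pose W (p : mR * vec) := dheat m (s - p.1) (fun z => G (p.1, z)) p.2.
  have W0 p : 0 <= W p by exact: dheat_ge0.
  have mW : measurable_fun [set: mR * vec] W by exact: measurable_dheat_curve.
  (* The indicator turns the integral over (0, s) into one over the whole line, so that Tonelli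
     applies on the full product. *)
  pose F (p : mR * vec) := (\1_(`]0%R, s[%classic : set mR) p.1)%:E * W p.
  have F0 p : 0 <= F p by apply: mule_ge0 => //; rewrite lee_fin.
  have mF : measurable_fun [set: mR * vec] F.
    apply: emeasurable_funM => //; apply/measurable_EFinP.
    by apply: (measurableT_comp (measurable_indic (mI s))); exact: measurable_fst.
  have intF y : \int[mu]_(r in `]0%R, s[) W (r, y) = \int[mu]_r F (r, y).
    rewrite integral_mkcond; apply: eq_integral => r _; rewrite patchE /F indicE/=.
    by case: (_ \in _); rewrite ?mul1e ?mul0e.
  rewrite (eq_dheat m (t - s) _
      (fun y => dheat m s (EFin \o U0) y + \int[mu]_r F (r, y))); last first.
    by move=> y yO; rewrite VE// duhamel ?(ltW st)// -intF.
  have mdheat : measurable_fun [set: vec] (dheat m s (EFin \o U0)).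
    apply: (@measurable_fun_fubini_tonelli_F _ _ _ _ _ leb
      (fun q : vec * vec => (kern m s q.1 q.2)%:E * (EFin \o U0) q.2)).
      apply: emeasurable_funM; last by apply: (measurableT_comp mU0').
      by apply/measurable_EFinP; exact: measurable_kern.
    by move=> q; apply: mule_ge0 => //; rewrite lee_fin kern_ge0.
  have mFF : measurable_fun [set: vec] (fun y => \int[mu]_r F (r, y)).
    exact: (@measurable_fun_fubini_tonelli_G _ _ _ _ _ mu F).
  have mk : measurable_fun [set: vec] (fun y => (kern m (t - s) x y)%:E).
    by apply/measurable_EFinP; exact: measurable_kernr.
  have k0 y : 0 <= (kern m (t - s) x y)%:E by rewrite lee_fin kern_ge0.
  rewrite /dheat; under eq_integral.
    move=> y _; rewrite ge0_muleDr; [|exact: dheat_ge0|exact: integral_ge0].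
    over.
  rewrite ge0_integralD//; first last.
  - exact: emeasurable_funM.
  - by move=> y _; apply: mule_ge0 => //; exact: integral_ge0.
  - exact: emeasurable_funM.
  - by move=> y _; apply: mule_ge0 => //; exact: dheat_ge0.
  rewrite -[\int[leb]_y (_ * dheat _ _ _ _)]/(dheat m (t - s) (dheat m s (EFin \o U0)) x).
  rewrite dheat_semigroup// subrK; congr (_ + _).
  pose K (p : mR * vec) := (kern m (t - s) x p.2)%:E * F p.
  have K0 p : 0 <= K p by apply: mule_ge0.
  have mK : measurable_fun [set: mR * vec] K.
    by apply: emeasurable_funM => //; apply: (measurableT_comp mk).
  transitivity (\int[leb]_y \int[mu]_r K (r, y)).
    apply: eq_integral => y _; rewrite /K /=; symmetry.
    exact: (@ge0_integralZl _ _ R mu _ measurableT (fun r => F (r, y))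
      (measurableT_comp mF (measurable_pair2 y)) _ (fun r _ => F0 _) (k0 y)).
  transitivity (\int[mu]_r \int[leb]_y K (r, y)).
    exact: (esym (fubini_tonelli K mK K0)).
  rewrite [RHS]integral_mkcond; apply: eq_integral => r _.
  rewrite patchE; case: ifPn => [|/negbTE] rs; last first.
    apply: integral0_eq => y _.
    by rewrite /K /F indicE/= rs mul0e mule0.
  have := rs; rewrite inE/= in_itv/= => /andP[r0 rs'].
  rewrite /H (_ : (t - r = (t - s) + (s - r))%R); last by rewrite addrA subrK.
  rewrite -dheat_semigroup ?subr_gt0//; last by apply: (measurableT_comp mG).
  by apply: eq_integral => y _; rewrite /K /F indicE/= rs mul1e.
have ut : (u t x)%:E = Phi t by rewrite duhamel.
have A0 : 0 <= dheat m t (EFin \o U0) x by exact: dheat_ge0.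
have Phi0 s : 0 <= Phi s by rewrite adde_ge0// integral_ge0.
have Phit s : (s <= t)%R -> Phi s <= (u t x)%:E.
  move=> st; rewrite ut leeD2l//; apply: ge0_subset_integral => //.
  - exact: measurable_funTS.
  - by move=> r /=; rewrite !in_itv/= => /andP[-> rs]; exact: lt_le_trans st.
have Phifin s : (s <= t)%R -> Phi s = (fine (Phi s))%:E.
  move=> st; rewrite fineK// ge0_fin_numE//.
  by apply: le_lt_trans (Phit s st) _; rewrite ltry.
have Afin : dheat m t (EFin \o U0) x = (fine (dheat m t (EFin \o U0) x))%:E.
  rewrite fineK// ge0_fin_numE//; apply: le_lt_trans (ltry (u t x)).
  by rewrite ut leeDl// integral_ge0.
exists (fine (dheat m t (EFin \o U0) x)) => //.
set A := fine _ in Afin *.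
have : (0 <= A)%R by rewrite fine_ge0.
rewrite le_eqVlt => /predU1P[<-|Ap]; first by rewrite powR0 ?gt_eqF// mulr0 ler01.
apply: (@euler_blowup R alpha t A (fine \o Phi)) => //=.
- move=> s /andP[s0 st]; rewrite -lee_fin -(Phifin _ (ltW st)) -Afin.
  by rewrite /Phi leeDl// integral_ge0.
- move=> s1 s2 s10 s12 s2t.
  have s1t := lt_trans s12 s2t.
  rewrite -lee_fin EFinD -(Phifin _ (ltW s1t)) -(Phifin _ (ltW s2t)) EFinM.
  have -> : Phi s2 = Phi s1 + \int[mu]_(r in `[s1, s2[) H r.
    have -> : Phi s2 = dheat m t (EFin \o U0) x +
        (\int[mu]_(r in `]0%R, s1[) H r + \int[mu]_(r in `[s1, s2[) H r).
      rewrite -ge0_integral_setU//.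
      + by rewrite -itv_bndbnd_setU ?bnd_simp//; exact: ltW.
      + exact: measurable_funTS.
      + apply/disj_setPLR => r /=; rewrite !in_itv/= => /andP[_ rs1].
        by apply/negP; rewrite negb_and -ltNge rs1.
    exact: addeA.
  rewrite leeD2l//.
  (* Constant lower bound for the rate on [s1, s2[: Jensen gives H(r) >= Phi(r)^{1+alpha}, and
     Phi(r) >= Phi(s1) by monotonicity. *)
  have -> : (s2 - s1)%:E * (fine (Phi s1) `^ (1 + alpha))%:E =
      \int[mu]_(r in `[s1, s2[) (fine (Phi s1) `^ (1 + alpha))%:E.
    by rewrite integral_cst//= lebesgue_measure_itv/= lte_fin s12 muleC.
  apply: ge0_le_integral => //.
  + by move=> r _; rewrite lee_fin powR_ge0.
  + exact: measurable_funTS.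
  move=> r /=; rewrite in_itv/= => /andP[s1r rs2].
  have r0 : (0 < r)%R by exact: lt_le_trans s1r.
  have rt : (r < t)%R by exact: lt_trans s2t.
  apply: (@le_trans _ _ (fine (Phi r) `^ (1 + alpha))%:E).
    rewrite lee_fin; apply: gt0_ler_powR.
    - by rewrite addr_gt0.
    - apply: lt_le_trans Ap _; rewrite -lee_fin -Afin -(Phifin _ (ltW s1t)).
      by rewrite /Phi leeDl// integral_ge0.
    - rewrite -lee_fin -(Phifin _ (ltW s1t)) -(Phifin _ (ltW rt)) leeD2l//.
      apply: ge0_subset_integral => //.
      + exact: measurable_funTS.
      + by move=> q /=; rewrite !in_itv/= => /andP[-> qs]; exact: lt_le_trans s1r.
  have tr0 : (0 < t - r)%R by rewrite subr_gt0.
  have mVr : measurable_fun [set: vec] (fun y => V (r, y) : mR).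
    exact: (measurableT_comp mV (measurable_pair1 r)).
  have := dheat_jensen m (t - r)%R (fun y => V (r, y)) alpha (fine (Phi r)) x tr0 a0 mVr.
  apply; first by move=> y; exact: V0.
  by rewrite -(Phifin _ (ltW rt)) -hV.
Qed.

End lifespan_bound.

(** * Null sets under dilations, and anti-symmetry almost everywhere *)

Section null_sets.
Context {R : realType} {N : nat}.
Local Notation mR := (measurableTypeR R).
Local Notation mu := (@lebesgue_measure R).
Local Notation leb := (lebesgue_rV R N).
Local Notation vec := 'rV[R]_N.

Lemma measurable_Omega m : measurable (Omega m : set vec).
Proof.
rewrite (_ : Omega m = \bigcap_(i in [set i : 'I_N | (i < m)%N])
    ((fun x : vec => x ord0 i : mR) @^-1` `]0, +oo[%classic)).
  apply: fin_bigcap_measurable => // i _.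
  rewrite -[X in measurable X]setTI; apply: (measurable_coor (T := R)) => //.
apply/seteqP; split => x /= xO i im /=; first by rewrite in_itv/= andbT xO.
by have := xO i im; rewrite /= in_itv/= andbT.
Qed.

Lemma ae_rV_dilate (c : 'I_N -> R) (P : set vec) : (forall i, c i != 0) ->
  {ae leb, forall x, P x} -> {ae leb, forall x, P (rV_dilate c x)}.
Proof.
move=> c0 [A [mA A0 PA]].
have mdA : measurable (rV_dilate c @^-1` A).
  by rewrite -[X in measurable X]setTI; exact: (@measurable_rV_dilate R N c measurableT A mA).
exists (rV_dilate c @^-1` A); split => //; last by move=> x /= Px; exact: PA.
have mf : measurable_fun [set: vec] (fun x => (\1_A x : R)%:E).
  by apply/measurable_EFinP; exact: measurable_indic.
have f0 x : (0 <= (\1_A x : R)%:E)%E by rewrite lee_fin.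
have := ge0_integral_rV_dilate N c _ c0 mf f0.
have -> : (\int[leb]_x (\1_A x)%:E = 0)%E by rewrite integral_indic// setIT; exact: A0.
rewrite mule0 => <-.
transitivity (\int[leb]_x (\1_(rV_dilate c @^-1` A) x)%:E)%E; last exact: eq_integral.
by rewrite integral_indic// setIT.
Qed.

(** The indicator of the hyperplane is a product of one-variable functions; the factor along [k] has
    integral 0, and 0 times infinity is 0 for the others. *)
Lemma ae_coor_neq0 (k : 'I_N) : {ae leb, forall x : vec, x ord0 k != 0}.
Proof.
have mA : measurable [set x : vec | x ord0 k = 0].
  rewrite -[X in measurable X]setTI.
  by apply: (measurable_coor (T := R) k measurableT (measurable_set1 (0 : R))).
exists [set x : vec | x ord0 k = 0]; split => //; last first.
  by move=> x /= /negP; rewrite negbK => /eqP.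
pose f (j : 'I_N) (a : mR) : R := if j == k then \1_[set 0] a else 1.
have := @ge0_integral_prod R N f.
rewrite [in X in (_ -> _ -> _ = X)%type -> _](bigD1 k)//= /f eqxx.
have -> : (\int[mu]_a (\1_[set 0%R] a : R)%:E = 0)%E.
  by rewrite integral_indic//= setIT; exact: lebesgue_measure_set1.
rewrite mul0e => <-//.
- transitivity (\int[leb]_x (\1_[set x : vec | x ord0 k = 0] x)%:E)%E.
    by rewrite integral_indic// setIT.
  apply: eq_integral => x _.
  congr (_%:E); rewrite (bigD1 k)//= eqxx big1 ?mulr1 => [|j /negPf ->//].
  by rewrite !indicE; congr (nat_of_bool _)%:R; apply/idP/idP; rewrite !inE.
- by move=> i; rewrite /f; case: (i == k) => //; exact: measurable_indic.
- by move=> i x; case: ifP.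
Qed.

Lemma reflect_coordE (i : 'I_N) (x : vec) :
  reflect_coord i x = rV_dilate (fun j => if j == i then -1 else 1) x.
Proof. by apply/rowP => j; rewrite !mxE; case: ifP; rewrite ?mulN1r ?mul1r. Qed.

(** The sign constraints are removed one coordinate at a time: at stage [k] only the coordinates
    from [k] to m-1 must be positive. Reflection covers the negative side, and the hyperplane
    between is null. *)
Lemma antisymmetric_ae_eq0 m (f : vec -> R) : (m <= N)%N ->
  antisymmetric_coords m f -> {ae leb, forall x, Omega m x -> f x = 0} ->
  {ae leb, forall x, f x = 0}.
Proof.
move=> mN fa f0.
suff H k : (k <= m)%N -> {ae leb, forall x : vec,
    (forall i : 'I_N, (k <= i < m)%N -> 0 < x ord0 i) -> f x = 0}.
  have := H m (leqnn m); apply: filterS => x; apply => i.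
  by move=> /andP[h1 h2]; have := leq_ltn_trans h1 h2; rewrite ltnn.
elim: k => [|k IH] km; first by apply: filterS f0 => x fx xO; apply: fx => i /xO.
have kN : (k < N)%N by exact: leq_trans mN.
pose i0 := Ordinal kN.
have IHk := IH (ltnW km).
have c0 (j : 'I_N) : (if j == i0 then -1 else 1 : R) != 0.
  by case: ifP; rewrite ?oppr_eq0 oner_eq0.
have FF := ae_filter_ringOfSetsType leb.
have H1 := @filterI _ _ FF _ _ IHk (ae_coor_neq0 i0).
have H2 := @filterI _ _ FF _ _ (fa i0 km) (ae_rV_dilate _ _ c0 IHk).
apply: (@filterS _ _ FF _ _ _ (@filterI _ _ FF _ _ H1 H2)) => x [[h1 h2] [h3 h4]] xD.
have [x0|x0|x0] := ltgtP 0 (x ord0 i0).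
- apply: h1 => i /andP[ki im]; have [ii0|ii0] := eqVneq i i0; first by rewrite ii0.
  apply: xD; rewrite im andbT ltn_neqAle ki andbT eq_sym.
  by apply: contra ii0 => /eqP ik; apply/eqP/val_inj.
- apply/eqP; rewrite -oppr_eq0 -h3 reflect_coordE; apply/eqP; apply: h4 => i /andP[ki im].
  rewrite mxE; have [ii0|ii0] := eqVneq i i0; first by rewrite ii0 mulN1r oppr_gt0.
  rewrite mul1r; apply: xD; rewrite im andbT ltn_neqAle ki andbT eq_sym.
  by apply: contra ii0 => /eqP ik; apply/eqP/val_inj.
- by move: h2; rewrite -x0 eqxx.
Qed.

End null_sets.

(** * Parabolic scaling of [psi0], of the kernel and of the heat flow *)

Section scaling.
Context {R : realType} {N : nat}.
Local Notation mR := (measurableTypeR R).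
Local Notation mu := (@lebesgue_measure R).
Local Notation leb := (lebesgue_rV R N).
Local Notation vec := 'rV[R]_N.

Lemma measurable_enorm : measurable_fun [set: vec] (@enorm R N : vec -> mR).
Proof.
rewrite (_ : @enorm R N = fun x : vec => (\sum_i x ord0 i ^+ 2) `^ 2^-1); last first.
  by apply/funext => x; rewrite powR12_sqrt// sumr_ge0// => i _; rewrite sqr_ge0.
apply: (measurableT_comp (measurable_powR 2^-1)); apply: measurable_sum => i.
by apply: measurable_funX; exact: (measurable_coor (T := R)).
Qed.

Lemma enormZ (r : R) (x : vec) : 0 <= r -> enorm (r *: x) = r * enorm x.
Proof.
move=> r0; rewrite /enorm; under eq_bigr do rewrite mxE exprMn.
by rewrite -mulr_sumr sqrtrM ?sqr_ge0// sqrtr_sqr ger0_norm.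
Qed.

Lemma OmegaZ m (r : R) (x : vec) : 0 < r -> Omega m (r *: x) <-> Omega m x.
Proof.
by move=> r0; split => xO i /xO; rewrite mxE pmulr_rgt0.
Qed.

Lemma measurable_psi0 m gamma : measurable_fun [set: vec] (psi0 m gamma : vec -> mR).
Proof.
apply: measurable_funM; last first.
  by apply: (measurableT_comp (measurable_powR _)); exact: measurable_enorm.
apply: measurable_funM => //.
rewrite [X in measurable_fun _ X](_ : _ =
    (fun x : vec => \prod_(i < N) (if (i < m)%N then x ord0 i else 1))); last first.
  by apply/funext => x; rewrite big_mkcond.
by apply: measurable_prod => i _; case: (i < m)%N;
  [exact: (measurable_coor (T := R) i)|exact: measurable_cst].
Qed.

Lemma psi0_gt0 m gamma (x : vec) : (0 < m <= N)%N -> 0 < gamma -> Omega m x ->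
  0 < psi0 m gamma x.
Proof.
move=> /andP[m0 mN] g0 xO; rewrite /psi0 mulr_gt0//.
  rewrite mulr_gt0//; last by apply: prodr_gt0 => i; exact: xO.
  by apply: prodr_gt0 => k _; rewrite ltr_wpDr// mulr_ge0.
have N0 : (0 < N)%N by exact: leq_trans mN.
rewrite powR_gt0// sqrtr_gt0 (bigD1 (Ordinal N0))//= ltr_pwDl//.
  by rewrite exprn_gt0// xO.
by rewrite sumr_ge0// => i _; rewrite sqr_ge0.
Qed.

(** Degree m from the coordinates and -gamma-2m from the norm. With r = sqrt t this is the origin of
    the exponent (gamma+m)/2. *)
Lemma psi0Z m gamma (r : R) (x : vec) : (m <= N)%N -> 0 < r ->
  psi0 m gamma (r *: x) = r `^ (- (gamma + m%:R)) * psi0 m gamma x.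
Proof.
move=> mN r0; have e0 : 0 <= enorm x by exact: sqrtr_ge0.
rewrite /psi0 (enormZ _ _ (ltW r0)) (powRM _ (ltW r0) e0).
under [X in _ * X * _]eq_bigr do rewrite mxE.
rewrite big_split/= -(big_ord_widen N (fun=> r) mN) prodr_const card_ord.
have -> : r `^ (- gamma - 2 * m%:R) = r `^ (- (gamma + m%:R)) * r `^ (- m%:R).
  by rewrite -powRD ?(gt_eqF r0) ?implybT//; congr (_ `^ _); ring.
rewrite [r `^ (- m%:R)]powRN (powR_mulrn m (ltW r0)).
by field; rewrite expf_neq0// gt_eqF.
Qed.

Lemma gaussZ (t s : R) : 0 < t ->
  gauss t (Num.sqrt t * s) = (Num.sqrt t)^-1 * gauss 1 s.
Proof.
move=> t0; rewrite /gauss.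
have -> : (Num.sqrt t * s) ^+ 2 / (4 * t) = s ^+ 2 / (4 * 1).
  by rewrite exprMn sqr_sqrtr ?ltW//; field; rewrite gt_eqF.
have -> : (4 * pi * t) `^ (- 2^-1) = (Num.sqrt t)^-1 * (4 * pi * 1) `^ (- 2^-1).
  have pi4 : (0 : R) <= 4 * pi by rewrite mulr_ge0// ltW// pi_gt0.
  by rewrite mulr1 (powRM _ pi4 (ltW t0)) mulrC [t `^ _]powRN powR12_sqrt// ltW.
by rewrite mulrA.
Qed.

Lemma kernZ m (t : R) (x y : vec) : 0 < t ->
  kern m t (Num.sqrt t *: x) (Num.sqrt t *: y) = (Num.sqrt t)^-1 ^+ N * kern m 1 x y.
Proof.
move=> t0; have s0 : 0 < Num.sqrt t by rewrite sqrtr_gt0.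
rewrite /kern -[X in _ ^+ X]card_ord -prodr_const -big_split/=.
apply: eq_bigr => i _; rewrite !mxE /kfac.
case: ifP => _; last by rewrite -mulrBr gaussZ.
rewrite t0 ltr01 !pmulr_rgt0//; case: ifP => _; last by rewrite mulr0.
by rewrite /dgauss -(mulrBr (Num.sqrt t)) -(mulrDr (Num.sqrt t)) !gaussZ// mulrBr.
Qed.

Local Open Scope ereal_scope.

Lemma ae_eq_dheat m t (f g : vec -> R) x :
  measurable_fun [set: vec] (f : vec -> mR) -> measurable_fun [set: vec] (g : vec -> mR) ->
  {ae leb, forall y, Omega m y -> f y = g y} ->
  dheat m t (EFin \o f) x = dheat m t (EFin \o g) x.
Proof.
move=> mf mg fg.
have mk : measurable_fun [set: vec] (fun y => (kern m t x y)%:E).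
  by apply/measurable_EFinP; exact: measurable_kernr.
apply: ae_eq_integral => //.
- by apply: emeasurable_funM => //; exact/measurable_EFinP.
- by apply: emeasurable_funM => //; exact/measurable_EFinP.
apply: filterS fg => y fg _ /=; have [/fg ->//|yO] := pselect (Omega m y).
by rewrite kern_eq0// !mul0e.
Qed.

Lemma ae_le_dheat m t (f g : vec -> \bar R) x :
  measurable_fun [set: vec] f -> measurable_fun [set: vec] g ->
  (forall y, 0 <= f y) -> (forall y, 0 <= g y) ->
  {ae leb, forall y, Omega m y -> f y <= g y} ->
  dheat m t f x <= dheat m t g x.
Proof.
move=> mf mg f0 g0 fg.
have mk : measurable_fun [set: vec] (fun y => (kern m t x y)%:E).
  by apply/measurable_EFinP; exact: measurable_kernr.
have k0 y : 0 <= (kern m t x y)%:E by rewrite lee_fin kern_ge0.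
apply: ae_ge0_le_integral => //.
- by move=> y _; exact: mule_ge0.
- exact: emeasurable_funM.
- by move=> y _; exact: mule_ge0.
- exact: emeasurable_funM.
apply: filterS fg => y fg _ /=; have [/fg fgy|yO] := pselect (Omega m y).
  exact: lee_wpmul2l.
by rewrite kern_eq0// !mul0e.
Qed.

Lemma dheatZl m t (f : vec -> \bar R) x (c : R) : measurable_fun [set: vec] f ->
  (forall y, 0 <= f y) -> (0 <= c)%R -> dheat m t (fun y => c%:E * f y) x = c%:E * dheat m t f x.
Proof.
move=> mf f0 c0.
have mk : measurable_fun [set: vec] (fun y => (kern m t x y)%:E).
  by apply/measurable_EFinP; exact: measurable_kernr.
rewrite /dheat -ge0_integralZl//.
- by apply: eq_integral => y _; rewrite muleCA.
- exact: emeasurable_funM.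
- by move=> y _; rewrite mule_ge0// lee_fin kern_ge0.
Qed.

(** The Jacobian t^{N/2} of the change of variables cancels the factor t^{-N/2} of [kernZ]. *)
Lemma dheat_sqrt m (t : R) (f : vec -> \bar R) x : (0 < t)%R ->
  measurable_fun [set: vec] f -> (forall y, 0 <= f y) ->
  dheat m t f (Num.sqrt t *: x) = dheat m 1 (fun y => f (Num.sqrt t *: y)) x.
Proof.
move=> t0 mf f0; set r := Num.sqrt t.
have r0 : (0 < r)%R by rewrite sqrtr_gt0.
pose F y := (kern m t (r *: x) y)%:E * f y.
have mF : measurable_fun [set: vec] F.
  by apply: emeasurable_funM => //; apply/measurable_EFinP; exact: measurable_kernr.
have F0 y : 0 <= F y by apply: mule_ge0 => //; rewrite lee_fin kern_ge0.
have rV_dilateZ y : rV_dilate (fun=> r) y = r *: y :> vec by apply/rowP => i; rewrite !mxE.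
have rN : (\prod_(i < N) `|r|^-1 = r^-1 ^+ N)%R by rewrite prodr_const card_ord gtr0_norm.
have h := ge0_integral_rV_dilate N (fun=> r) F (fun=> lt0r_neq0 r0) mF F0.
rewrite rN in h.
have -> : dheat m t f (r *: x) = (r ^+ N)%:E * \int[leb]_y F (rV_dilate (fun=> r) y).
  rewrite h muleA -EFinM -exprMn divff ?gt_eqF// expr1n mul1e//.
rewrite -ge0_integralZl//.
- apply: eq_integral => y _; rewrite rV_dilateZ /F kernZ// !muleA -EFinM.
  by rewrite mulrA -exprMn divff ?gt_eqF// expr1n mul1r.
- by apply: (measurableT_comp mF); exact: measurable_rV_dilate.
- by rewrite lee_fin exprn_ge0// ltW.
Qed.

End scaling.

(** * The lifespan bound for data lambda phi *)

Section lifespan_of_data.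
Context {R : realType} {N : nat}.
Local Notation mR := (measurableTypeR R).
Local Notation leb := (lebesgue_rV R N).
Local Notation vec := 'rV[R]_N.
Implicit Types (m : nat) (gamma alpha lambda t c M : R) (x y : vec) (phi omega : vec -> R).

(** The positive part gives a function nonnegative everywhere that coincides with omega psi_0 almost
    everywhere in Omega_m when omega is nonnegative there. *)
Definition full_profile m gamma omega y : R := Num.max 0 (omega y * psi0 m gamma y).

Definition profile m gamma omega M y : R :=
  if enorm y <= M then full_profile m gamma omega y else 0.

Lemma full_profile_ge0 m gamma omega y : 0 <= full_profile m gamma omega y.
Proof. by rewrite /full_profile le_max lexx. Qed.

Lemma profile_ge0 m gamma omega M y : 0 <= profile m gamma omega M y.
Proof. by rewrite /profile; case: ifP => // _; exact: full_profile_ge0. Qed.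

Lemma measurable_full_profile m gamma omega :
  measurable_fun [set: vec] (omega : vec -> mR) ->
  measurable_fun [set: vec] (full_profile m gamma omega : vec -> mR).
Proof.
move=> mw; apply: measurable_maxr => //.
by apply: measurable_funM => //; exact: measurable_psi0.
Qed.

Lemma measurable_profile m gamma omega M : measurable_fun [set: vec] (omega : vec -> mR) ->
  measurable_fun [set: vec] (profile m gamma omega M : vec -> mR).
Proof.
move=> mw; apply: measurable_fun_ifT => //; last exact: measurable_full_profile.
by apply: measurable_fun_ler => //; exact: measurable_enorm.
Qed.

Lemma le_profile m gamma omega M M' y : M <= M' ->
  profile m gamma omega M y <= profile m gamma omega M' y.
Proof.
move=> MM'; rewrite /profile; case: ifP => h; first by rewrite (le_trans h MM').
by case: ifP => // _; exact: full_profile_ge0.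
Qed.

Lemma profileZ m gamma omega M (r : R) : (m <= N)%N -> 0 < r -> homogeneous0 omega ->
  {ae leb, forall y, profile m gamma omega M (r *: y) =
     r `^ (- (gamma + m%:R)) * profile m gamma omega (M / r) y}.
Proof.
move=> mN r0 wh; apply: filterS (wh r r0) => y wy; rewrite /profile /full_profile wy psi0Z//.
rewrite (enormZ _ _ (ltW r0)) ler_pdivlMr// [r * _]mulrC; case: ifP => _; last by rewrite mulr0.
by rewrite mulrCA maxr_pMr ?powR_ge0// mulr0.
Qed.

(** Only values in Omega_m enter, which suffices for the Dirichlet flow; this is the [U0] of
    [mild_solution_bound]. *)
Definition pos_data m lambda phi y : R := Num.max 0 (((fun y => lambda * phi y) \_ (Omega m)) y).

Lemma measurable_pos_data m lambda phi : measurable_fun (Omega m) (phi : vec -> mR) ->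
  measurable_fun [set: vec] (pos_data m lambda phi : vec -> mR).
Proof.
move=> mphi; apply: measurable_maxr => //.
apply/(measurable_restrictT _ (measurable_Omega m)).
exact: measurable_funM.
Qed.

Lemma pos_data_ge0 m lambda phi y : 0 <= pos_data m lambda phi y.
Proof. by rewrite /pos_data le_max lexx. Qed.

Lemma heat_pos_data m lambda phi t x : 0 <= lambda -> 0 < t -> Omega m x ->
  measurable_fun (Omega m) (phi : vec -> mR) ->
  {ae leb, forall y, Omega m y -> 0 <= phi y} ->
  heat m t (fun y => lambda * phi y) x = dheat m t (EFin \o pos_data m lambda phi) x.
Proof.
move=> l0 t0 xO mphi phi0; rewrite heat_dheat//.
transitivity (dheat m t (EFin \o ((fun y => lambda * phi y) \_ (Omega m))) x).
  by apply: eq_dheat => y yO; rewrite /= patchE mem_set.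
apply: ae_eq_dheat.
- apply/(measurable_restrictT _ (measurable_Omega m)).
  exact: measurable_funM.
- exact: measurable_pos_data.
- apply: filterS phi0 => y phi0 yO; rewrite /pos_data patchE mem_set//.
  by rewrite max_r// mulr_ge0// phi0.
Qed.

Local Open Scope ereal_scope.

Lemma dheat_pos_data_ge m gamma lambda phi omega (eps : R) t x :
  (m <= N)%N -> (0 < lambda)%R -> (0 < t)%R ->
  measurable_fun (Omega m) (phi : vec -> mR) ->
  measurable_fun [set: vec] (omega : vec -> mR) -> homogeneous0 omega ->
  {ae leb, forall y, Omega m y -> (0 <= phi y)%R} ->
  {ae leb, forall y, Omega m y -> (enorm y <= eps)%R ->
    (omega y * psi0 m gamma y <= phi y)%R} ->
  (lambda * Num.sqrt t `^ (- (gamma + m%:R)))%:E *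
    dheat m 1 (EFin \o profile m gamma omega (eps / Num.sqrt t)) x <=
  dheat m t (EFin \o pos_data m lambda phi) (Num.sqrt t *: x).
Proof.
move=> mN l0 t0 mphi mw wh phi0 phiw; set r := Num.sqrt t.
have r0 : (0 < r)%R by rewrite sqrtr_gt0.
set g := (r `^ (- (gamma + m%:R)))%R.
have g0 : (0 <= g)%R by exact: powR_ge0.
have p0 M y : 0 <= (EFin \o profile m gamma omega M) y by rewrite lee_fin profile_ge0.
have mp M : measurable_fun [set: vec] (EFin \o profile m gamma omega M).
  by apply/measurable_EFinP; exact: measurable_profile.
have mr : measurable_fun [set: vec] ((fun y => r *: y) : vec -> vec).
  rewrite (_ : (fun y => r *: y) = rV_dilate (fun=> r)); first exact: measurable_rV_dilate.
  by apply/funext => y; apply/rowP => i; rewrite !mxE.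
have E1 : dheat m t (EFin \o profile m gamma omega eps) (r *: x) =
    dheat m 1 (EFin \o (fun y => profile m gamma omega eps (r *: y))) x.
  exact: (dheat_sqrt m t (EFin \o profile m gamma omega eps) x t0 (mp eps) (p0 eps)).
have E2 : dheat m 1 (EFin \o (fun y => profile m gamma omega eps (r *: y))) x =
    dheat m 1 (EFin \o (fun y => g * profile m gamma omega (eps / r) y)%R) x.
  apply: ae_eq_dheat.
  - exact: (measurableT_comp (measurable_profile m gamma omega eps mw) mr).
  - exact: (measurable_funM (measurable_cst g) (measurable_profile m gamma omega (eps / r) mw)).
  - by apply: filterS (profileZ m gamma omega eps r mN r0 wh) => y ->.
have E3 : dheat m 1 (EFin \o (fun y => g * profile m gamma omega (eps / r) y)%R) x =
    g%:E * dheat m 1 (EFin \o profile m gamma omega (eps / r)) x.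
  exact: (dheatZl m 1 (EFin \o profile m gamma omega (eps / r)) x g (mp _) (p0 _) g0).
rewrite EFinM -muleA -E3 -E2 -E1.
rewrite -(dheatZl m t (EFin \o profile m gamma omega eps) (r *: x) lambda (mp _) (p0 _) (ltW l0)).
apply: ae_le_dheat.
- exact: (measurable_funeM lambda%:E (mp eps)).
- by apply/measurable_EFinP; exact: measurable_pos_data.
- by move=> y; apply: mule_ge0; [rewrite lee_fin; exact: ltW|exact: p0].
- by move=> y; rewrite lee_fin pos_data_ge0.
have FF := ae_filter_ringOfSetsType leb.
apply: (@filterS _ _ FF _ _ _ (@filterI _ _ FF _ _ phi0 phiw)) => y [h1 h2] yO.
suff : (lambda * profile m gamma omega eps y <= pos_data m lambda phi y)%R.
  by rewrite -lee_fin EFinM.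
rewrite /pos_data patchE (mem_set yO) /profile /full_profile.
clear E1 E2 E3 mr mp p0.
have ly : (0 <= lambda * phi y)%R := mulr_ge0 (ltW l0) (h1 yO).
rewrite /= (max_r ly); case: ifP => [ye|_]; last by rewrite mulr0.
by rewrite ler_pM2l// ge_max (h1 yO)/= (h2 yO).
Qed.

(** The hypothesis is raised to the power 1/(alpha q), after which [t] has exponent (1/alpha -
    g/2)/q = 1. *)
Lemma lifespan_exponents alpha q t lambda c (g : R) :
  (0 < alpha -> 0 < t -> 0 < lambda -> 0 < c -> 0 < q -> q = alpha^-1 - g / 2 ->
  alpha * t * (lambda * Num.sqrt t `^ (- g) * c) `^ alpha <= 1 ->
  (alpha `^ alpha^-1 * c) `^ q^-1 * (lambda `^ q^-1 * t) <= 1)%R.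
Proof.
move=> a0 t0 l0 c0 q0 qE h.
have -> : ((alpha `^ alpha^-1 * c) `^ q^-1 * (lambda `^ q^-1 * t) =
  (alpha * t * (lambda * Num.sqrt t `^ (- g) * c) `^ alpha) `^ (alpha^-1 / q))%R.
  have an := ltW a0; have tn := ltW t0; have ln := ltW l0; have cn := ltW c0.
  have -> : (((lambda * Num.sqrt t `^ (- g) * c) `^ alpha) =
      (lambda * c * t `^ (2^-1 * - g)) `^ alpha)%R.
    by rewrite powRrM powR12_sqrt// mulrAC.
  rewrite (powRM _ (mulr_ge0 an tn) (powR_ge0 _ _)) -(powRrM _ alpha).
  have -> : (alpha * (alpha^-1 / q) = q^-1)%R by field; rewrite !gt_eqF.
  rewrite (powRM _ an tn) (powRM _ (mulr_ge0 ln cn) (powR_ge0 _ _)) (powRM _ ln cn).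
  rewrite (powRM _ (powR_ge0 _ _) cn) -(powRrM alpha) -(powRrM t).
  have tE : (t = t `^ (alpha^-1 / q) * t `^ (2^-1 * - g * q^-1))%R.
    rewrite -powRD ?(gt_eqF t0) ?implybT//.
    rewrite -[LHS]powRr1//; congr (_ `^ _)%R.
    by rewrite -mulrDl mulrN [(2^-1 * g)%R]mulrC -qE divff// gt_eqF.
  by rewrite [in LHS]tE; ring.
have e1 : (1 `^ (alpha^-1 / q) = 1 :> R)%R by rewrite powR1.
rewrite -[leRHS]e1; apply: ge0_ler_powR => //.
- by rewrite mulr_ge0// invr_ge0 ltW.
- by rewrite nnegrE mulr_ge0 ?powR_ge0// mulr_ge0// ltW.
- by rewrite nnegrE.
Qed.

(** If T > D, the condition on [D] leaves room for a time t in (D, T) with t < (eps/M)^2. Then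
    eps/sqrt t >= M, so [c] bounds the rescaled heat value from below and the bound forces t <= D. A
    real [c] is used since the heat value might be infinite. *)
Lemma mild_solution_lifespan m gamma alpha lambda phi omega (eps c M : R) T u x :
  let q := (alpha^-1 - (gamma + m%:R) / 2)%R in
  (0 < alpha)%R -> (0 < q)%R -> (m <= N)%N -> (0 < lambda)%R -> (0 < eps)%R ->
  measurable_fun (Omega m) (phi : vec -> mR) ->
  measurable_fun [set: vec] (omega : vec -> mR) -> homogeneous0 omega ->
  {ae leb, forall y, Omega m y -> (0 <= phi y)%R} ->
  {ae leb, forall y, Omega m y -> (enorm y <= eps)%R ->
    (omega y * psi0 m gamma y <= phi y)%R} ->
  (0 < c)%R -> (0 < M)%R -> Omega m x ->
  c%:E <= dheat m 1 (EFin \o profile m gamma omega M) x ->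
  let D := (((alpha `^ alpha^-1 * c) `^ q^-1)^-1 / lambda `^ q^-1)%R in
  (D < (eps / M) ^+ 2)%R ->
  mild_solution m alpha (fun y => lambda * phi y)%R T u -> T <= D%:E.
Proof.
move=> q a0 q0 mN l0 eps0 mphi mw wh phi0 phiw c0 M0 xO cI D Dt0 sol.
have K0 : (0 < (alpha `^ alpha^-1 * c) `^ q^-1)%R by rewrite powR_gt0// mulr_gt0// powR_gt0.
have L0 : (0 < lambda `^ q^-1)%R by rewrite powR_gt0.
have D0 : (0 < D)%R by rewrite mulr_gt0 ?invr_gt0.
rewrite leNgt; apply/negP => DT.
have [t [Dt tt0 tT]] : exists t, [/\ (D < t)%R, (t < (eps / M) ^+ 2)%R & t%:E < T].
  have mid (b : R) : (D < b)%R -> exists2 t, (D < t)%R & (t < b)%R.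
    by move=> Db; exists ((D + b) / 2)%R; lra.
  case: T DT {sol} => [T'||]//.
  - rewrite lte_fin => DT; have [t Dt tb] := mid (Num.min T' ((eps / M) ^+ 2))%R
      (ltac:(by rewrite lt_min DT Dt0)).
    by move: tb; rewrite lt_min => /andP[t1 t2]; exists t; split.
  - by move=> _; have [t Dt tb] := mid _ Dt0; exists t; split => //; rewrite ltry.
have t0 : (0 < t)%R by exact: lt_trans Dt.
have r0 : (0 < Num.sqrt t)%R by rewrite sqrtr_gt0.
have rxO : Omega m (Num.sqrt t *: x) by apply/OmegaZ.
have heatU s y : (0 < s)%R -> Omega m y ->
    heat m s (fun y => lambda * phi y)%R y = dheat m s (EFin \o pos_data m lambda phi) y.
  by move=> s0 yO; apply: heat_pos_data => //; exact: ltW.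
have [A hA bound] := mild_solution_bound m alpha _ (pos_data m lambda phi) T u t _ a0 sol
  (measurable_pos_data m lambda phi mphi) (pos_data_ge0 m lambda phi) heatU t0 tT rxO.
have MM : (M <= eps / Num.sqrt t)%R.
  rewrite ler_pdivlMr// mulrC -ler_pdivlMr//.
  rewrite -[leRHS]gtr0_norm ?divr_gt0// -sqrtr_sqr.
  by apply: ler_wsqrtr; exact: ltW.
have lowA : ((lambda * Num.sqrt t `^ (- (gamma + m%:R))) * c <= A)%R.
  rewrite -lee_fin -hA; apply: le_trans (dheat_pos_data_ge m gamma lambda phi omega eps t x
    mN l0 t0 mphi mw wh phi0 phiw).
  rewrite EFinM; apply: lee_wpmul2l; first by rewrite lee_fin mulr_ge0 ?powR_ge0// ltW.
  apply: le_trans cI _; apply: ae_le_dheat.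
  - by apply/measurable_EFinP; exact: measurable_profile.
  - by apply/measurable_EFinP; exact: measurable_profile.
  - by move=> y; rewrite lee_fin profile_ge0.
  - by move=> y; rewrite lee_fin profile_ge0.
  - by apply: aeW => y _; rewrite lee_fin le_profile.
have := lifespan_exponents alpha q t lambda c (gamma + m%:R) a0 t0 l0 c0 q0 erefl.
have B0 : (0 < lambda * Num.sqrt t `^ (- (gamma + m%:R)) * c)%R.
  by rewrite !mulr_gt0// powR_gt0.
have bound' : (alpha * t * (lambda * Num.sqrt t `^ (- (gamma + m%:R)) * c) `^ alpha <= 1)%R.
  by apply: le_trans bound; rewrite ler_pM2l ?mulr_gt0//; exact: gt0_ler_powR.
move=> /(_ bound'); apply/negP; rewrite -ltNge -ltr_pdivrMl// mulr1 -ltr_pdivrMl//.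
by rewrite mulrC.
Qed.

End lifespan_of_data.

(** * Removal of the cut-off, positivity and norms *)

Section profile_limit.
Context {R : realType} {N : nat}.
Local Notation mR := (measurableTypeR R).
Local Notation leb := (lebesgue_rV R N).
Local Notation vec := 'rV[R]_N.
Local Open Scope ereal_scope.

(** Monotone convergence along the radii n+1; at each fixed point the integrands are eventually
    constant. *)
Lemma dheat_full_profile_le m gamma (omega : vec -> R) (b : \bar R) (x : vec) :
  measurable_fun [set: vec] (omega : vec -> mR) ->
  (forall M : R, (0 < M)%R -> dheat m 1 (EFin \o profile m gamma omega M) x <= b) ->
  dheat m 1 (EFin \o full_profile m gamma omega) x <= b.
Proof.
move=> mw hb.
pose g (n : nat) y := (kern m 1 x y)%:E * (profile m gamma omega n.+1%:R y)%:E.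
have mg n : measurable_fun [set: vec] (g n).
  apply: emeasurable_funM; apply/measurable_EFinP; first exact: measurable_kernr.
  exact: measurable_profile.
have g0 n y : 0 <= g n y.
  by apply: mule_ge0; rewrite lee_fin; [exact: kern_ge0|exact: profile_ge0].
have ndg y : {homo g ^~ y : n k / (n <= k)%N >-> n <= k}.
  move=> n k nk; apply: lee_wpmul2l; first by rewrite lee_fin kern_ge0.
  by rewrite lee_fin le_profile// ler_nat.
have gE y : limn (g ^~ y) = (kern m 1 x y)%:E * (full_profile m gamma omega y)%:E.
  apply/cvg_lim => //; apply: cvg_near_cst; near=> n.
  rewrite /g /profile ifT//.
  have : (enorm y <= n%:R)%R by near: n; exact: nbhs_infty_ger.
  by move/le_trans; apply; rewrite ler_nat.
have -> : dheat m 1 (EFin \o full_profile m gamma omega) x = limn (fun n => \int[leb]_y g n y).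
  rewrite -monotone_convergence//.
  by apply: eq_integral => y _; rewrite gE.
apply: lime_le.
  apply: ereal_nondecreasing_is_cvgn => n k nk; apply: ge0_le_integral => //.
  by move=> y _; exact: ndg.
by apply: nearW => n; exact: hb.
Unshelve. all: by end_near. Qed.

(** A zero integral would make omega vanish almost everywhere in Omega_m, the kernel and [psi0]
    being positive there, and then on R^N by anti-symmetry. *)
Lemma dheat_full_profile_gt0 m gamma (omega : vec -> R) (x : vec) :
  (0 < m <= N)%N -> (0 < gamma)%R -> Omega m x ->
  measurable_fun [set: vec] (omega : vec -> mR) -> antisymmetric_coords m omega ->
  {ae leb, forall y, Omega m y -> (0 <= omega y)%R} ->
  ~ {ae leb, forall y, omega y = 0%R} ->
  0 < dheat m 1 (EFin \o full_profile m gamma omega) x.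
Proof.
move=> mN gamma0 xO mw wa w0 wn0.
have /andP[_ mN'] := mN.
pose F y := (kern m 1 x y)%:E * (full_profile m gamma omega y)%:E.
have F0 y : 0 <= F y.
  apply: mule_ge0; rewrite lee_fin; first exact: kern_ge0.
  exact: full_profile_ge0.
have mF : measurable_fun [set: vec] F.
  apply: emeasurable_funM; apply/measurable_EFinP; first exact: measurable_kernr.
  exact: measurable_full_profile.
rewrite lt_neqAle integral_ge0 ?andbT//; last by move=> y _; exact: F0.
apply/negP => /eqP I0; apply: wn0; apply: (antisymmetric_ae_eq0 m) => //.
have /(ae_eq_integral_abs leb measurableT mF) Fae : \int[leb]_y `|F y| = 0.
  by rewrite I0; apply: eq_integral => y _; rewrite gee0_abs.
have FF := ae_filter_ringOfSetsType leb.
apply: (@filterS _ _ FF _ _ _ (@filterI _ _ FF _ _ w0 Fae)) => y [h1 h2] yO.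
apply/eqP; rewrite eq_le h1// andbT leNgt; apply/negP => wy.
have := h2 Logic.I; rewrite /F /cst/= -EFinM => -[] /eqP.
rewrite mulf_eq0 gt_eqF/= ?kern_gt0// /full_profile max_r.
  by rewrite mulf_eq0 !gt_eqF// psi0_gt0.
by rewrite mulr_ge0 ?ltW// psi0_gt0.
Qed.

Lemma heat_full_profile m gamma (omega : vec -> R) (x : vec) :
  (0 < m <= N)%N -> (0 < gamma)%R -> Omega m x ->
  measurable_fun [set: vec] (omega : vec -> mR) ->
  {ae leb, forall y, Omega m y -> (0 <= omega y)%R} ->
  heat m 1 (fun y => omega y * psi0 m gamma y)%R x =
  dheat m 1 (EFin \o full_profile m gamma omega) x.
Proof.
move=> mN gamma0 xO mw w0; rewrite heat_dheat//; apply: ae_eq_dheat.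
- exact: (measurable_funM mw (measurable_psi0 m gamma)).
- exact: measurable_full_profile.
- apply: filterS w0 => y w0 yO; rewrite /full_profile max_r//.
  by rewrite mulr_ge0 ?w0// ltW// psi0_gt0.
Qed.

Lemma Linfty_norm_le (D : set vec) (f : vec -> \bar R) (b : R) : (0 <= b)%R ->
  (forall x, D x -> 0 <= f x <= b%:E) -> 'N[leb]_+oo[f \_ D] <= b%:E.
Proof.
move=> b0 fb; rewrite Lnorm.unlock; case: ifP => _; last by rewrite lee_fin.
apply/ess_supP/aeW => x /=; rewrite patchE; case: ifPn => [/set_mem/fb/andP[f0 fxb]|_].
  by rewrite gee0_abs.
by rewrite abse0 lee_fin.
Qed.

Lemma limf_esup_le (T : choiceType) (X : filteredType T) (f : X -> \bar R)
    (F : set_system X) (y : \bar R) : (\forall x \near F, f x <= y) -> limf_esup f F <= y.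
Proof.
move=> fy; apply: (@le_trans _ _ (ereal_sup (f @` [set x | f x <= y]))).
  by apply: ereal_inf_lbound; exists [set x | f x <= y].
by apply: ge_ereal_sup => _ [x /= fx <-].
Qed.

End profile_limit.

(** * From bounds at finite lambda to the limsup *)

Theorem theorem1p10 (R : realType) (N m : nat) (alpha gamma : R)
    (hm : (1 <= m <= N)%N)
    (hgamma : 0 < gamma < N%:R)
    (halpha : 0 < alpha < 2 / (gamma + m%:R))
    (phi : 'rV[R]_N -> R)
    (phi_L1loc : L1loc [set x | x != 0] phi)
    (phi_antisym : antisymmetric_coords m phi)
    (phi_X : Xspace m gamma phi)
    (phi_ge0 : {ae lebesgue_rV R N, forall x, Omega m x -> 0 <= phi x})
    (omega : 'rV[R]_N -> R)
    (omega_Linfty : Linfty setT omega)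
    (omega_homogeneous : homogeneous0 omega)
    (omega_antisym : antisymmetric_coords m omega)
    (omega_ge0 : {ae lebesgue_rV R N, forall x, Omega m x -> 0 <= omega x})
    (omega_neq0 : ~ {ae lebesgue_rV R N, forall x, omega x = 0})
    (eps : R) (eps_gt0 : 0 < eps)
    (phi_ge : {ae lebesgue_rV R N, forall x, Omega m x -> enorm x <= eps ->
                 omega x * psi0 m gamma x <= phi x}) :
  let p := (alpha^-1 - (gamma + m%:R) / 2)^-1 in
  (\forall lambda \near +oo_R,
     (Tmax m alpha (fun x => lambda * phi x)%R < +oo)%E) /\
  (limf_esup (fun lambda : R =>
      (lambda `^ p)%:E * Tmax m alpha (fun x => lambda * phi x)%R) (+oo_R)
   <= (((alpha `^ alpha^-1)%:E *
        'N[lebesgue_rV R N]_+oo [ (heat m 1 (fun x => omega x * psi0 m gamma x)%R)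
                                    \_ (Omega m) ]) `^ p)^-1)%E.
Proof.
have /andP[a0 aub] := halpha; have /andP[g0 _] := hgamma.
have /andP[m0 mN] := hm.
have gm0 : 0 < gamma + m%:R by rewrite ltr_pwDl.
set q := alpha^-1 - (gamma + m%:R) / 2.
have q0 : 0 < q.
  by rewrite subr_gt0 -[X in X < _]invrK ltf_pV2 ?posrE ?invr_gt0 ?divr_gt0// invf_div.
move=> p; have p0 : 0 < p by rewrite invr_gt0.
have mphi : measurable_fun (Omega m) (phi : 'rV[R]_N -> measurableTypeR R) by case: phi_X => -[].
have mw : measurable_fun [set: 'rV[R]_N] (omega : 'rV[R]_N -> measurableTypeR R).
  by case: omega_Linfty.
set K := alpha `^ alpha^-1; have K0 : 0 < K by rewrite powR_gt0.
pose I M x := dheat m 1 (EFin \o profile m gamma omega M) x.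
have lifespan c M x : 0 < c -> 0 < M -> Omega m x -> (c%:E <= I M x)%E ->
    \forall lambda \near +oo_R, 0 < lambda /\
      (Tmax m alpha (fun x => lambda * phi x)%R <= (((K * c) `^ p)^-1 / lambda `^ p)%:E)%E.
  move=> c0 M0 xO cI; set D := ((K * c) `^ p)^-1.
  have D0 : 0 < D by rewrite invr_gt0 powR_gt0// mulr_gt0.
  have e0 : 0 < (eps / M) ^+ 2 by rewrite exprn_gt0// divr_gt0.
  have De0 : 0 < D / (eps / M) ^+ 2 by rewrite divr_gt0.
  near=> lambda.
  have l0 : 0 < lambda by near: lambda; exact: nbhs_pinfty_gt.
  (* Raised to the power p = 1/q, this says that the bound on the lifespan is below (eps/M)^2. *)
  have lD : (D / (eps / M) ^+ 2) `^ q < lambda by near: lambda; exact: nbhs_pinfty_gt.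
  split => //; apply: ge_ereal_sup => T [u sol].
  apply: (@mild_solution_lifespan R N m gamma alpha lambda phi omega eps c M T u x) => //.
  have : D / (eps / M) ^+ 2 < lambda `^ p.
    have h : ((D / (eps / M) ^+ 2) `^ q) `^ p < lambda `^ p.
      by apply: gt0_ltr_powR => //; rewrite nnegrE ?powR_ge0// ltW.
    by move: h; rewrite -powRrM /p divff ?gt_eqF// (powRr1 (ltW De0)).
  by rewrite ltr_pdivrMr// mulrC -ltr_pdivrMr// powR_gt0.
set ell := limf_esup _ _.
have esup c M x : 0 < c -> 0 < M -> Omega m x -> (c%:E <= I M x)%E ->
    (ell <= ((K * c) `^ p)^-1%:E)%E.
  move=> c0 M0 xO cI; apply: limf_esup_le.
  apply: filterS (lifespan c M x c0 M0 xO cI) => lambda [l0 Tl].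
  apply: (@le_trans _ _ ((lambda `^ p)%:E * (((K * c) `^ p)^-1 / lambda `^ p)%:E)%E).
    by apply: lee_wpmul2l => //; rewrite lee_fin powR_ge0.
  by rewrite -EFinM mulrCA divff ?mulr1// gt_eqF// powR_gt0.
pose one : 'rV[R]_N := const_mx 1.
have oneO : Omega m one by move=> i _; rewrite mxE.
(* One positive cut-off value, at an arbitrary point of Omega_m, already yields a finite existence
   time and a limsup below infinity. *)
have [M1 M10 [c1 c10 cI1]] : exists2 M, 0 < M & exists2 c, 0 < c & (c%:E <= I M one)%E.
  apply: contrapT => hno.
  have : (0 < dheat m 1 (EFin \o full_profile m gamma omega) one)%E.
    exact: dheat_full_profile_gt0.
  rewrite ltNge => /negP; apply; apply: dheat_full_profile_le => // M M0.
  rewrite leNgt; apply/negP => I0; apply: hno; exists M => //.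
  move: I0; rewrite -[dheat _ _ _ _]/(I M one); case: (I M one) => [r| |] //.
  - by rewrite lte_fin => r0; exists r.
  - by move=> _; exists 1 => //; rewrite leey.
split.
  apply: filterS (lifespan c1 M1 one c10 M10 oneO cI1) => lambda [_ Tl].
  by apply: le_lt_trans Tl _; rewrite ltry.
have := esup c1 M1 one c10 M10 oneO cI1.
have [l0 _|l0] := leP ell 0%E.
  by apply: le_trans l0 _; rewrite inve_ge0 poweR_ge0.
move: ell l0 esup; case=> [l| |]//; rewrite lte_fin => l0 esup _.
(* Chosen so that ((K b)^p)^{-1} = l. A cut-off value above [b] would admit some c > b, for which
   [esup] bounds the limsup strictly below [l]. *)
pose b := (l^-1) `^ q / K.
have b0 : 0 <= b by rewrite divr_ge0 ?powR_ge0// ltW.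
have Ib M x : 0 < M -> Omega m x -> (I M x <= b%:E)%E.
  move=> M0 xO; rewrite leNgt; apply/negP => bI.
  have [c bc cI] : exists2 c, b < c & (c%:E <= I M x)%E.
    case: (I M x) bI => [r| |] //; first by rewrite lte_fin => br; exists r.
    by move=> _; exists (b + 1); [rewrite ltrDl|rewrite leey].
  have c0 : 0 < c by exact: le_lt_trans bc.
  have Kc0 : 0 < K * c by rewrite mulr_gt0.
  have := esup c M x c0 M0 xO cI; rewrite lee_fin => lKc.
  have : (K * c) `^ p <= l^-1.
    by rewrite -[leLHS]invrK lef_pV2 ?posrE ?invr_gt0 ?powR_gt0.
  move=> /(gt0_ler_powR q _ _ q0 (powR_gt0 _ Kc0)).
  rewrite -powRrM /p mulVf ?gt_eqF// (powRr1 (ltW Kc0)) => h.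
  by move: bc; rewrite ltNge ler_pdivlMr// mulrC h.
set n := ('N[_]_+oo[_])%E.
have n0 : (0 <= n)%E by exact: Lnorm_ge0.
have nb : (n <= b%:E)%E.
  apply: Linfty_norm_le => // x xO; rewrite heat_full_profile//; apply/andP; split.
    by apply: dheat_ge0 => y; rewrite lee_fin full_profile_ge0.
  by apply: dheat_full_profile_le => // M M0; exact: Ib.
move: n0 nb; case: n => [r| |]//; rewrite !lee_fin => r0 rb.
(* The inverse of 0 is infinite here, so a vanishing power leaves nothing to prove. *)
rewrite -EFinM poweR_EFin inver; case: ifPn => [_|Kr]; first by rewrite leey.
have Krp : 0 < (K * r) `^ p by rewrite lt_neqAle eq_sym Kr powR_ge0.
rewrite lee_fin -[leLHS]invrK lef_pV2 ?posrE ?invr_gt0//.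
have -> : l^-1 = (l^-1 `^ q) `^ p.
  by rewrite -powRrM /p divff ?gt_eqF// powRr1// invr_ge0 ltW.
apply: ge0_ler_powR; rewrite ?nnegrE ?powR_ge0//.
- exact: ltW.
- by rewrite mulr_ge0// ltW.
- by rewrite mulrC -ler_pdivlMr.
Unshelve. all: by end_near. Qed.
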